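(* For every constant $K>0$, with high probability, for every integer $k$ with $0\le k\le \frac{n}{150K\log n}$, \[|\mathcal L_k\cap C_{\tau_{\mathrm{end}}}|\ge \Big(1-\frac1{n^K}\Big)\binom nk.\]
   Context: Let $n\ge 1$ and $\mathcal B=\{0,1\}^n$ with the coordinatewise partial order; $\mathbf 0=(0,\dots,0)$, $\mathbf 1=(1,\dots,1)$, $|x|$ denotes the number of ones of $x$, and $\mathcal L_k=\{x\in\mathcal B:|x|=k\}$ is the $k$th level, so $|\mathcal L_k|=\binom nk$. A random decreasing walk from $\mathbf 1$ is a maximal chain $\mathbf 1=x_n>x_{n-1}>\dots>x_0=\mathbf 0$ with $x_i\in\mathcal L_i$, chosen uniformly among all $n!$ such chains (equivalently, each step turns a uniformly random remaining $1$ into $0$). The DLA process on $\mathcal B$: $C_0=\{\mathbf 0\}$; for $t\ge1$, let $\rho_t$ be a random decreasing walk from $\mathbf 1$, independent of everything before; let $v$ be the last vertex of the longest initial segment of $\rho_t$ that is disjoint from $C_{t-1}$, and set $C_t=C_{t-1}\cup\{v\}$. The process terminates at the first time $\tau_{\mathrm{end}}$ with $\mathbf 1\in C_{\tau_{\mathrm{end}}}$ (for $t>\tau_{\mathrm{end}}$ put $C_t=C_{\tau_{\mathrm{end}}}$). A vertex is occupied at time $t$ if it lies in $C_t$. ''With high probability'' (w.h.p.) means with probability tending to $1$ as $n\to\infty$; $\log$ is the natural logarithm. *)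

(* Defs.v *)
From Stdlib Require Import Reals.
From mathcomp Require Import all_boot all_fingroup.

Set Implicit Arguments.
Unset Strict Implicit.
Unset Printing Implicit Defensive.

(* A vertex x of B = {0,1}^n is encoded as the set of coordinates where x_i = 1;
   |x| = #|x|, the partial order is inclusion, 0 = set0, 1 = setT. *)

(* A random decreasing walk is encoded by a permutation s : 'S_n :
   at step j+1 the coordinate s j is turned from 1 to 0.  The vertex reached
   after j steps (j = 0..n) is the set of coordinates not yet turned off,
   i.e. those i with removal time s^-1 i >= j.  Uniform s <-> uniform chain. *)
Definition walk_vertex (n : nat) (s : 'S_n) (j : nat) : {set 'I_n} :=
  [set i : 'I_n | j <= (s^-1)%g i].

(* One DLA step.  h = index of the first vertex of the walk lying in C.
   If h = 0 then 1 is in C (process has terminated): C is unchanged.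
   Otherwise the longest initial segment disjoint from C is x_0..x_{h-1}
   and its last vertex is added. *)
Definition dla_step (n : nat) (C : {set {set 'I_n}}) (s : 'S_n)
    : {set {set 'I_n}} :=
  let h := find (fun j => walk_vertex s j \in C) (iota 0 n.+1) in
  if h == 0 then C else C :|: [set walk_vertex s h.-1].

Definition cluster_after (n : nat) (w : seq 'S_n) : {set {set 'I_n}} :=
  foldl (@dla_step n) [set set0] w.

(* Since C strictly grows until 1 is occupied, tau_end <= 2^n - 1, so the
   final cluster C_{tau_end} equals C_{2^n}.  Sample space: 2^n independent
   uniform walks. *)
Definition Omega (n : nat) := {ffun 'I_(2 ^ n) -> 'S_n}.

Definition final_cluster (n : nat) (w : Omega n) : {set {set 'I_n}} :=
  cluster_after [seq w i | i <- enum 'I_(2 ^ n)].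

Definition level_count (n : nat) (C : {set {set 'I_n}}) (k : nat) : nat :=
  #|[set x in C | #|x| == k]|.

Definition Rleb (a b : R) : bool := if Rle_dec a b then true else false.

(* The event: for every k with 0 <= k <= n/(150 K log n),
   |L_k ∩ C| >= (1 - 1/n^K) binom(n,k).  (For k > n both sides vanish,
   so only k <= n need be checked.) *)
Definition good_event (n : nat) (K : R) (C : {set {set 'I_n}}) : bool :=
  [forall k : 'I_n.+1,
     Rleb (INR k) (Rdiv (INR n) (Rmult (Rmult (IZR 150) K) (ln (INR n)))) ==>
     Rleb (Rmult (Rminus R1 (Rinv (Rpower (INR n) K))) (INR 'C(n, k)))
          (INR (level_count C k))].

Definition prob_good (n : nat) (K : R) : R :=
  Rdiv (INR #|[set w : Omega n | good_event K (final_cluster w)]|)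
       (INR #|{: Omega n}|).

(* Main.v *)
Require Import Defs.
From Stdlib Require Import Reals.
From mathcomp Require Import all_boot all_fingroup.
From mathcomp Require Import all_order all_algebra reals Rstruct.
From mathcomp Require Import ring lra zify.

(* Write N_k = 'C(n, k), let q = floor (n / (150 K log n)), and watch level k at
   time T_k = N_(k+1) / 20.  A vertex on level j is hit by a walk with
   probability 1 / N_j, so up to time T_k few of the vertices above level k can
   be occupied.  More precisely:
   - the expected population of level j+1 at time t is at most t / N_j times
     that of level j, so at time T_q levels n/3 and higher are empty;
   - for x on level k <= q, the fraction of the walks through x that are
     stopped strictly above x is at most a sum over the first T_k walks of
     independent variables of size O(1/n) and total mean at most 1/10; a
     Chernoff bound keeps it below 1/4 for every x with probability
     1 - exp (- c n), and there are only exp (o(n)) vertices x.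
   If in addition half of the lower neighbours of x are occupied, the next walk
   occupies x with probability at least 1 / (4 N_k).  Hence a fixed set Y of such
   vertices stays empty during (T_(k-1), T_k] with probability at most
   exp (- #|Y| (T_k - T_(k-1)) / (4 N_k)).  Taking for Y the sets of at least
   half of the lower neighbours of a vertex of level k+1 gives, by induction on k,
   that all vertices have half of their lower neighbours occupied in time;
   taking for Y the subsets of level k with more than N_k / n^K elements
   gives the theorem. *)

Set Implicit Arguments.
Unset Strict Implicit.
Unset Printing Implicit Defensive.

Import Order.TTheory GRing.Theory Num.Theory.
Local Open Scope ring_scope.
Bind Scope ring_scope with R.

(** * Averages over words of independent uniform letters *)

Lemma exp_ge1Dx (x : R) : 1 + x <= exp x.
Proof. by apply/RleP; apply: exp_ineq1_le. Qed.

Lemma exp_ge0 (x : R) : 0 <= exp x.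
Proof. by apply/RleP/Rlt_le/exp_pos. Qed.

Lemma exp_add (a b : R) : exp (a + b) = exp a * exp b.
Proof. exact: exp_plus. Qed.

Lemma exp_le (a b : R) : a <= b -> exp a <= exp b.
Proof.
rewrite le_eqVlt => /orP[/eqP->//|/RltP ab].
by apply/RleP/Rlt_le/exp_increasing.
Qed.

Lemma exp_mulrn (a : R) t : exp a ^+ t = exp (t%:R * a).
Proof.
elim: t => [|t IH]; first by rewrite mul0r exp_0.
by rewrite exprS IH -exp_add -natr1 mulrDl mul1r addrC.
Qed.

(** From [exp (- (u / 2)) >= 1 - u / 2] and [(1 + u) * (1 - u / 2) >= 1] on [0, 1]. *)
Lemma exp_half (u : R) : 0 <= u <= 1 -> exp (u / 2) <= 1 + u.
Proof.
move=> /andP[u0 u1]; have h := exp_ge1Dx (- (u / 2)).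
have e : exp (u / 2) * exp (- (u / 2)) = 1.
  have := exp_plus (u / 2) (- (u / 2)); rewrite RplusE subrr exp_0 => h'.
  exact: esym.
have p := exp_ge0 (u / 2).
have : exp (u / 2) * (1 - u / 2) <= 1 by rewrite -[X in _ <= X]e ler_wpM2l.
nra.
Qed.

(** The inverses at least halve at each step, so a geometric series dominates the sum. *)
Lemma sum_inv_geom (f : nat -> R) a M :
  (forall j, (a <= j < M)%N -> 0 < f j) ->
  (forall j, (a <= j)%N -> (j.+1 < M)%N -> 2 * f j <= f j.+1) ->
  (a < M)%N -> \sum_(a <= j < M) (f j)^-1 <= 2 / f a.
Proof.
have [d] := ubnP (M - a); elim: d a => // d IH a; rewrite ltnS => Mad f0 f2 aM.
rewrite big_ltn //; have fa : 0 < f a by apply: f0; lia.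
have [aM1|aM1] := leqP M a.+1.
  by rewrite big_geq // addr0 ler_peMl ?invr_ge0 ?(ltW fa) //; lra.
have fa1 : 0 < f a.+1 by apply: f0; lia.
have h : \sum_(a.+1 <= j < M) (f j)^-1 <= 2 / f a.+1.
  apply: IH => // [|j ?|j ? ?]; [lia|apply: f0; lia|apply: f2; lia].
have h' : (f a.+1)^-1 <= (2 * f a)^-1.
  by rewrite lef_pV2 ?posrE ?mulr_gt0 //; apply: f2.
by move: h h'; rewrite invfM; lra.
Qed.

(** The ratio of consecutive binomials is [(m - j) / (j + 1)], at least 2 in the lower third. This
    is why all levels considered lie below n/3. *)
Lemma bin_double m j : (3 * j.+1 <= m.+1)%N -> (2 * 'C(m, j) <= 'C(m, j.+1))%N.
Proof.
move=> h; rewrite -(@leq_pmul2l j.+1) // mul_bin_left mulnA leq_mul //; lia.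
Qed.

Lemma bin_incr m i j : (3 * j <= m.+1)%N -> (i <= j)%N -> ('C(m, i) <= 'C(m, j))%N.
Proof.
move=> jm; elim: j jm => [|j IH] jm; first by case: i.
rewrite leq_eqVlt => /orP[/eqP->//|ij]; apply: leq_trans (bin_double jm).
by have := IH _ ij; lia.
Qed.

Lemma sum_bin_inv m a M : (3 * M <= m.+3)%N -> (a < M)%N ->
  \sum_(a <= j < M) ('C(m, j)%:R)^-1 <= 2 / 'C(m, a)%:R :> R.
Proof.
move=> Mm aM; apply: (sum_inv_geom (f := fun j => 'C(m, j)%:R)) => //.
  by move=> j hj; rewrite ltr0n bin_gt0; lia.
by move=> j ja jM; rewrite -natrM ler_nat; apply: bin_double; lia.
Qed.

Section Expectation.

Variable S : finType.
Hypothesis S_gt0 : (0 < #|S|)%N.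

Definition avg (f : S -> R) : R := (\sum_s f s) / #|S|%:R.

(** Expectation over t independent uniform letters. Recursion on the first letter makes conditioning
    on a prefix ([Ex_cat]) a plain unfolding. *)
Fixpoint Ex (t : nat) (F : seq S -> R) : R :=
  if t is t'.+1 then avg (fun s => Ex t' (fun w => F (s :: w))) else F [::].

Definition Pr (t : nat) (P : pred (seq S)) : R := Ex t (fun w => (P w)%:R).

Let cardS_gt0 : 0 < #|S|%:R :> R.
Proof. by rewrite ltr0n. Qed.

Lemma avg_le f g : (forall s, f s <= g s) -> avg f <= avg g.
Proof.
by move=> fg; rewrite /avg ler_pM2r ?invr_gt0 //; apply: ler_sum => s _.
Qed.

Lemma eq_avg f g : f =1 g -> avg f = avg g.
Proof. by move=> fg; congr (_ / _); apply: eq_bigr => s _. Qed.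

Lemma avg_cst c : avg (fun=> c) = c.
Proof.
have eqc : \sum_(s : S) c = c * #|S|%:R by rewrite sumr_const mulr_natr.
by rewrite /avg eqc mulfK // gt_eqF.
Qed.

Lemma avgD f g : avg (fun s => f s + g s) = avg f + avg g.
Proof. by rewrite /avg big_split mulrDl. Qed.

Lemma avgZ c f : avg (fun s => c * f s) = c * avg f.
Proof. by rewrite /avg -mulr_sumr mulrA. Qed.

Lemma avg_sum (I : Type) (r : seq I) (P : pred I) (f : I -> S -> R) :
  avg (fun s => \sum_(i <- r | P i) f i s) = \sum_(i <- r | P i) avg (f i).
Proof. by rewrite /avg exchange_big mulr_suml. Qed.

Lemma avg_pred (P : pred S) : avg (fun s => (P s)%:R) = #|P|%:R / #|S|%:R.
Proof.
by congr (_ / _); rewrite -natr_sum -sum1_card [in RHS]big_mkcond.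
Qed.

Lemma Ex_le_size t F G :
  (forall w, size w = t -> F w <= G w) -> Ex t F <= Ex t G.
Proof.
elim: t F G => [|t IH] F G FG /=; first exact: FG.
by apply: avg_le => s; apply: IH => w sw; apply: FG; rewrite /= sw.
Qed.

Lemma Ex_le t F G : (forall w, F w <= G w) -> Ex t F <= Ex t G.
Proof. by move=> FG; apply: Ex_le_size => w _. Qed.

Lemma eq_Ex t F G : F =1 G -> Ex t F = Ex t G.
Proof. by move=> FG; apply/eqP; rewrite eq_le !Ex_le // => w; rewrite FG. Qed.

Lemma Ex_cst t c : Ex t (fun=> c) = c.
Proof. by elim: t => //= t IH; rewrite IH avg_cst. Qed.

Lemma ExD t F G : Ex t (fun w => F w + G w) = Ex t F + Ex t G.
Proof.
by elim: t F G => //= t IH F G; rewrite -avgD; apply: eq_avg => s.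
Qed.

Lemma ExZ t c F : Ex t (fun w => c * F w) = c * Ex t F.
Proof.
by elim: t F => //= t IH F; rewrite -avgZ; apply: eq_avg => s.
Qed.

Lemma Ex_sum (I : Type) (r : seq I) (P : pred I) t (F : I -> seq S -> R) :
  Ex t (fun w => \sum_(i <- r | P i) F i w) = \sum_(i <- r | P i) Ex t (F i).
Proof.
elim: r => [|i r IH].
  rewrite big_nil -[RHS](Ex_cst t); apply: eq_Ex => w; exact: big_nil.
rewrite big_cons -IH; case: ifPn => Pi.
  by rewrite -ExD; apply: eq_Ex => w; rewrite big_cons Pi.
by apply: eq_Ex => w; rewrite big_cons (negbTE Pi).
Qed.

Lemma Ex_cat a b F :
  Ex (a + b) F = Ex a (fun u => Ex b (fun v => F (u ++ v))).
Proof. by elim: a F => //= a IH F; apply: eq_avg => s; rewrite IH. Qed.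

Lemma Ex_rcons t F : Ex t.+1 F = Ex t (fun u => avg (fun s => F (rcons u s))).
Proof.
rewrite -addn1 Ex_cat; apply: eq_Ex => u /=.
by apply: eq_avg => s; rewrite cats1.
Qed.

Lemma Ex_take t N F :
  (t <= N)%N -> Ex N (fun w => F (take t w)) = Ex t F.
Proof.
move=> tN; rewrite -(subnKC tN) Ex_cat.
apply/eqP; rewrite eq_le; apply/andP; split; apply: Ex_le_size => u su;
  by rewrite -{1}[F u](Ex_cst (N - t)) ?subnKC //; apply: Ex_le => v;
     rewrite take_size_cat.
Qed.

Lemma Ex_prod t (f : S -> R) : Ex t (fun w => \prod_(s <- w) f s) = avg f ^+ t.
Proof.
elim: t => [|t IH] /=; first by rewrite big_nil.
rewrite exprS -IH mulrC -avgZ; apply: eq_avg => s; rewrite mulrC -ExZ.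
by apply: eq_Ex => w; rewrite big_cons.
Qed.

(** Links the recursive expectation to counting in the sample space: a function on N+1 points is its
    first value together with the remaining ones. *)
Lemma Ex_ffun N (F : seq S -> R) :
  \sum_(w : {ffun 'I_N -> S}) F [seq w i | i <- enum 'I_N]
  = #|S|%:R ^+ N * Ex N F.
Proof.
elim: N F => [|N IH] F /=.
  rewrite mul1r (eq_bigr (fun=> F [::])); last first.
    by move=> w _; rewrite enum_ord0.
  by rewrite sumr_const card_ffun card_ord expn0.
pose cns (p : S * {ffun 'I_N -> S}) : {ffun 'I_N.+1 -> S} :=
  [ffun i => oapp p.2 p.1 (unlift ord0 i)].
pose unc (w : {ffun 'I_N.+1 -> S}) : S * {ffun 'I_N -> S} :=
  (w ord0, [ffun i => w (lift ord0 i)]).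
have cnsK : cancel cns unc.
  case=> s u; rewrite /unc /cns; congr pair; first by rewrite ffunE unlift_none.
  by apply/ffunP => i; rewrite !ffunE liftK.
have uncK : cancel unc cns.
  move=> w; apply/ffunP => i; rewrite /unc /cns ffunE /=.
  by case: unliftP => [j|] -> //=; rewrite ffunE.
rewrite (reindex cns) /=; last by exists unc => p _; [apply: cnsK|apply: uncK].
rewrite exprSr -mulrA /avg [_ * (_ / _)]mulrC divfK ?gt_eqF // mulr_sumr.
transitivity (\sum_s \sum_u F [seq cns (s, u) i | i <- enum 'I_N.+1]).
  by rewrite pair_bigA; apply: eq_bigr => -[].
apply: eq_bigr => s _; rewrite -IH; apply: eq_bigr => u _; congr F.
rewrite enum_ordSl /= ffunE unlift_none /= -map_comp; congr cons.
by apply: eq_map => i /=; rewrite ffunE liftK.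
Qed.

Lemma Pr_ffun N (P : pred (seq S)) :
  #|[set w : {ffun 'I_N -> S} | P [seq w i | i <- enum 'I_N]]|%:R
    / #|{: {ffun 'I_N -> S}}|%:R = Pr N P.
Proof.
rewrite card_ffun card_ord natrX -sum1_card natr_sum big_mkcond /=.
rewrite (eq_bigr (fun w : {ffun 'I_N -> S} =>
  (P [seq w i | i <- enum 'I_N])%:R)); last by move=> w _; rewrite inE; case: (P _).
by rewrite (Ex_ffun _ (fun w => (P w)%:R)) mulrC mulKf // expf_neq0 // gt_eqF.
Qed.

Lemma Pr_le t (P Q : pred (seq S)) : (forall w, P w -> Q w) -> Pr t P <= Pr t Q.
Proof.
by move=> PQ; apply: Ex_le => w; rewrite ler_nat; case: (P w) (PQ w) => // ->.
Qed.

Lemma PrC t (P : pred (seq S)) : Pr t (fun w => ~~ P w) = 1 - Pr t P.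
Proof.
apply/eqP; rewrite eq_sym subr_eq addrC -ExD -{1}(Ex_cst t 1).
by apply/eqP/eq_Ex => w; case: (P w); rewrite ?addr0 ?add0r.
Qed.

Lemma Pr_or t (P Q : pred (seq S)) : Pr t (fun w => P w || Q w) <= Pr t P + Pr t Q.
Proof.
by rewrite -ExD; apply: Ex_le => w; case: (P w); case: (Q w); rewrite /=; lra.
Qed.

Lemma Pr_has (I : eqType) (r : seq I) t (P : I -> pred (seq S)) :
  Pr t (fun w => has (P^~ w) r) <= \sum_(i <- r) Pr t (P i).
Proof.
rewrite -Ex_sum; apply: Ex_le => w; elim: r => [|i r IH] /=.
  by rewrite big_nil.
rewrite big_cons; case: (P i w) => //=; last by rewrite add0r.
by rewrite lerDl sumr_ge0.
Qed.

Lemma Pr_take t N (P : pred (seq S)) : (t <= N)%N -> Pr N (fun w => P (take t w)) = Pr t P.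
Proof. exact: (@Ex_take t N (fun w => (P w)%:R)). Qed.

Lemma Pr_exists (I : finType) (A : pred I) t (P : I -> pred (seq S)) :
  Pr t (fun w => [exists i in A, P i w]) <= \sum_(i in A) Pr t (P i).
Proof.
rewrite -big_enum; apply: le_trans (Pr_has _ _ _).
by apply: Pr_le => w /exists_inP[i Ai Pi]; apply/hasP; exists i; rewrite ?mem_enum.
Qed.

Lemma Pr_markov t (P : pred (seq S)) (F : seq S -> R) (b : R) :
  (forall w, 0 <= F w) -> (forall w, P w -> b <= F w) -> b * Pr t P <= Ex t F.
Proof.
move=> F0 FP; rewrite -ExZ; apply: Ex_le => w.
by case: (P w) (FP w) => [h|_]; rewrite ?mulr1 ?mulr0 // h.
Qed.

End Expectation.

(** * Counting walks through given vertices *)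

Section Walks.

Variable n : nat.
Implicit Types (s p : 'S_n) (x y z : {set 'I_n}) (C : {set {set 'I_n}}).
Local Open Scope nat_scope.

(* The vertex of the walk on level k, rather than after k steps. *)
Definition lv s k := walk_vertex s (n - k).

Lemma walk_vertexE s j : walk_vertex s j = s @: [set i : 'I_n | j <= i].
Proof.
apply/setP => i; rewrite inE; apply/idP/imsetP => [h|[i' + ->]].
  by exists ((s^-1)%g i); rewrite ?inE // permKV.
by rewrite inE permK.
Qed.

Lemma card_geq_ord j : #|[set i : 'I_n | j <= i]| = n - j.
Proof.
have sumE m : \sum_(0 <= i < m) (j <= i : nat) = m - j.
  elim: m => [|m IH]; first by rewrite big_geq.
  by rewrite big_nat_recr //= IH; case: leqP; lia.
rewrite -sum1_card -sumE big_mkord big_mkcond.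
by apply: eq_bigr => i _; rewrite inE; case: ifP.
Qed.

Lemma card_walk_vertex s j : #|walk_vertex s j| = n - j.
Proof. by rewrite walk_vertexE card_imset ?card_geq_ord //; apply: perm_inj. Qed.

Lemma card_lv s k : k <= n -> #|lv s k| = k.
Proof. by move=> kn; rewrite /lv card_walk_vertex subKn. Qed.

Lemma lv_mono s k j : k <= j -> lv s k \subset lv s j.
Proof.
move=> kj; apply/subsetP => i; rewrite !inE; apply: leq_trans.
exact: leq_sub2l.
Qed.

Lemma lv_mul s p k : lv (s * p)%g k = p @: lv s k.
Proof.
rewrite /lv !walk_vertexE -imset_comp; apply: eq_imset => i.
by rewrite permM.
Qed.

(** Equal class sizes make the two tuples of colours rearrangements of each other. *)
Lemma perm_of_classes (c c' : 'I_n -> nat) :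
  (forall v, #|[pred i | c i == v]| = #|[pred i | c' i == v]|) ->
  exists p : 'S_n, forall i, c' (p i) = c i.
Proof.
move=> cc'.
have /tuple_permP[p Hp] : perm_eq [tuple c i | i < n] [tuple c' i | i < n].
  have cnt f v : count (preim f (pred1 v)) (enum 'I_n) = #|[pred i | f i == v]|.
    by rewrite enumT cardE /enum_mem size_filter; apply: eq_count.
  apply/allP => v _; apply/eqP; move: (cc' v); rewrite -!cnt -!count_map.
  exact.
exists p => i.
have /(congr1 (fun t : n.-tuple nat => tnth t i)) := val_inj Hp.
by rewrite !tnth_mktuple.
Qed.

(** Colour each coordinate by how many of the two nested sets contain it; the class sizes then
    depend only on the cardinals. *)
Lemma perm_of_flags x z x' z' : x \subset z -> x' \subset z' ->
  #|x| = #|x'| -> #|z| = #|z'| ->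
  exists p : 'S_n, p @: x = x' /\ p @: z = z'.
Proof.
move=> xz xz' cx cz.
pose c (a b : {set 'I_n}) (i : 'I_n) := (i \in a) + (i \in b).
have cE (a b : {set 'I_n}) v : a \subset b -> #|[pred i | c a b i == v]| =
    if v == 0 then n - #|b| else if v == 1 then #|b| - #|a| else
    if v == 2 then #|a| else 0.
  move=> ab; have sub i : i \in a -> i \in b by move/(subsetP ab).
  case: v => [|[|[|v]]] /=.
  - transitivity #|~: b|; last by rewrite cardsCs setCK card_ord.
    apply: eq_card => i; rewrite !inE /c.
    by case: (i \in a) (sub i) => [->|_] //; case: (i \in b).
  - transitivity #|b :\: a|; last first.
      by rewrite cardsD (setIidPr ab).
    apply: eq_card => i; rewrite !inE /c.
    by case: (i \in a) (sub i) => [->|_] //; case: (i \in b).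
  - apply: eq_card => i; rewrite !inE /c.
    by case: (i \in a) (sub i) => [->|_] //; case: (i \in b).
  - by apply: eq_card0 => i; rewrite !inE /c; case: (_ \in _); case: (_ \in _).
have [p Hp] : exists p : 'S_n, forall i, c x' z' (p i) = c x z i.
  by apply: perm_of_classes => v; rewrite !cE // cx cz.
have mapE (A B : {set 'I_n}) : (forall i, (p i \in B) = (i \in A)) -> p @: A = B.
  move=> h; apply/setP => i; rewrite -[i](permKV p) h mem_imset //.
  exact: perm_inj.
exists p; split; apply: mapE => i;
  move: (Hp i) (subsetP xz i) (subsetP xz' (p i)); rewrite /c;
  case: (i \in x); case: (i \in z); case: (p i \in x'); case: (p i \in z') => //= _ h1 h2;
  by first [have := h1 isT | have := h2 isT].
Qed.

Definition thru x := [set s : 'S_n | lv s #|x| == x].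

Lemma card_mul_perm (A B : {set 'S_n}) p :
  (forall s, (s \in A) = ((s * p)%g \in B)) -> #|A| = #|B|.
Proof.
move=> AB; rewrite -!sum1_card [RHS](reindex (fun s => (s * p)%g)) /=.
  by apply: eq_bigl => s; apply: AB.
by exists (fun s => (s * p^-1)%g) => s _; rewrite ?mulgK ?mulgKV.
Qed.

Lemma eq_imset_perm p x y : (p @: x == p @: y) = (x == y).
Proof. by rewrite (inj_eq (imset_inj (@perm_inj _ p))). Qed.

Lemma card_thru2_perm p x z :
  #|thru (p @: x) :&: thru (p @: z)| = #|thru x :&: thru z|.
Proof.
symmetry; apply: (@card_mul_perm _ _ p) => s.
by rewrite !inE !lv_mul !card_imset ?eq_imset_perm //; apply: perm_inj.
Qed.

(* The sets [thru x :&: thru z'], z' in Z, partition [thru x] and are permuted by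
   the stabilizer of x. *)
Lemma card_thru_uniform x z (Z : {set {set 'I_n}}) : z \in Z ->
  (forall s, s \in thru x -> exists2 z', z' \in Z & s \in thru z') ->
  (forall z1 z2, z1 \in Z -> z2 \in Z -> #|z1| = #|z2|) ->
  (forall z', z' \in Z -> exists p : 'S_n, p @: x = x /\ p @: z = z') ->
  #|thru x :&: thru z| * #|Z| = #|thru x|.
Proof.
move=> zZ cov eqc tr.
rewrite mulnC -sum_nat_const -[RHS]sum1_card.
have eqn z' : z' \in Z -> #|thru x :&: thru z| = \sum_(s in thru x) (s \in thru z').
  move=> z'Z; have [p [px <-]] := tr _ z'Z.
  rewrite -(card_thru2_perm p) px -sum1_card.
  by rewrite [RHS](big_setID (thru (p @: z))) /= [X in _ = _ + X]big1 ?addn0 => [|s];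
    [apply: eq_bigr => s; rewrite inE => /andP[_ ->]|rewrite inE => /andP[/negbTE->]].
rewrite (eq_bigr _ eqn) exchange_big /=; apply: eq_bigr => s sx.
have [z1 z1Z sz1] := cov _ sx.
rewrite (bigD1 z1) //= sz1 big1 ?addn0 // => z2 /andP[z2Z].
apply: contraNeq; rewrite eqb0 negbK !inE in sz1 * => h.
by rewrite -(eqP h) (eqc _ _ z2Z z1Z) (eqP sz1).
Qed.

Lemma card_supersets x j : j <= n ->
  #|[set z : {set 'I_n} | (x \subset z) && (#|z| == j)]| = 'C(n - #|x|, n - j).
Proof.
move=> jn; rewrite -(card_imset _ (@setC_inj _)).
have -> : n - #|x| = #|~: x| by rewrite [RHS]cardsCs setCK card_ord.
rewrite -cards_draws; apply: eq_card => z.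
rewrite -[z in LHS]setCK mem_imset; last exact: setC_inj.
rewrite !inE -setCS setCK; congr andb.
have := cardsC z; rewrite card_ord; have := max_card (mem z); rewrite card_ord.
by move=> h1 h2; apply/eqP/eqP; lia.
Qed.

Lemma thru_sub s x j : s \in thru x -> #|x| <= j -> x \subset lv s j.
Proof. by rewrite inE => /eqP e ?; rewrite -{1}e lv_mono. Qed.

Lemma sub_thru s x j : s \in thru x -> j <= #|x| -> lv s j \subset x.
Proof. by rewrite inE => /eqP e ?; rewrite -{1}e lv_mono. Qed.

Lemma leq_card_n x : #|x| <= n.
Proof. by rewrite -[X in _ <= X]card_ord max_card. Qed.

Lemma lv_thru s j : j <= n -> s \in thru (lv s j).
Proof. by move=> jn; rewrite inE card_lv. Qed.

Lemma card_thru_up x z : x \subset z ->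
  #|thru x :&: thru z| * 'C(n - #|x|, #|z| - #|x|) = #|thru x|.
Proof.
move=> xz; have zn := leq_card_n z; have cxz := subset_leq_card xz.
have -> : 'C(n - #|x|, #|z| - #|x|) =
    #|[set z' : {set 'I_n} | (x \subset z') && (#|z'| == #|z|)]|.
  rewrite card_supersets // -bin_sub; last exact: leq_sub2r.
  by congr 'C(_, _); lia.
apply: card_thru_uniform.
- by rewrite inE xz eqxx.
- move=> s sx; exists (lv s #|z|); last exact: lv_thru.
  by rewrite inE card_lv // eqxx (thru_sub sx).
- by move=> z1 z2; rewrite !inE => /andP[_ /eqP->] /andP[_ /eqP->].
- by move=> z'; rewrite inE => /andP[? /eqP ?]; apply: perm_of_flags.
Qed.

Lemma card_thru_down x y : y \subset x ->
  #|thru x :&: thru y| * 'C(#|x|, #|y|) = #|thru x|.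
Proof.
move=> yx; have xn := leq_card_n x; have cyx := subset_leq_card yx.
rewrite -cards_draws; apply: card_thru_uniform.
- by rewrite inE yx eqxx.
- move=> s sx; exists (lv s #|y|); last by apply: lv_thru; apply: leq_trans xn.
  by rewrite inE card_lv ?eqxx ?(sub_thru sx) // (leq_trans cyx).
- by move=> z1 z2; rewrite !inE => /andP[_ /eqP->] /andP[_ /eqP->].
- move=> y'; rewrite inE => /andP[yx' /eqP cy].
  by have [p [? ?]] := perm_of_flags yx yx' (esym cy) erefl; exists p.
Qed.

Lemma card_thru x : #|thru x| * 'C(n, #|x|) = n`!.
Proof.
have thruT : thru set0 = setT.
  apply/setP => s; rewrite !inE cards0 -cards_eq0 card_lv //.
by have := card_thru_up (sub0set x); rewrite cards0 !subn0 thruT setTI cardsT card_Sn.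
Qed.

End Walks.

(** * One step of the process *)

Section Growth.

Variable n : nat.
Implicit Types (s p : 'S_n) (x y z : {set 'I_n}) (C D : {set {set 'I_n}}).
Local Open Scope nat_scope.

Lemma step_sub C s : C \subset dla_step C s.
Proof. by rewrite /dla_step; case: ifP => // _; apply: subsetUl. Qed.

Lemma step_adds C s x : 0 < #|x| -> s \in thru x -> lv s #|x|.-1 \in C ->
  (forall j, #|x| <= j <= n -> lv s j \notin C) -> x \in dla_step C s.
Proof.
move=> x0 sx low up; have xn := leq_card_n x.
(* The first hit is on level [#|x| - 1]; the index just before it, [n - #|x|], is that of x. *)
have hE : find (fun j => walk_vertex s j \in C) (iota 0 n.+1) = n - #|x|.-1.
  have -> : n.+1 = (n - #|x|.-1) + #|x| by lia.
  rewrite iotaD add0n find_cat ifF; last first.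
    apply/hasP => -[j]; rewrite mem_iota add0n => /andP[_ jn].
    have := up (n - j); rewrite /lv subKn; last by lia.
    by move=> /(_ _)/negbTE -> //; lia.
  rewrite size_iota -(prednK x0) /= -[X in walk_vertex s X]/(n - #|x|.-1).
  by rewrite -/(lv s _) low addn0.
rewrite /dla_step hE ifF; last by apply/eqP; lia.
rewrite inE; apply/orP; right; rewrite inE eq_sym; move: sx; rewrite inE /lv.
by have -> : (n - #|x|.-1).-1 = n - #|x| by lia.
Qed.

(** A step adds at most one vertex, determined by C and s; hence additions of distinct vertices are
    disjoint events. *)
Lemma step_newP C s z : set0 \in C -> z \in dla_step C s -> z \notin C ->
  z = walk_vertex s (find (fun j => walk_vertex s j \in C) (iota 0 n.+1)).-1.
Proof.
move=> C0; rewrite /dla_step; case: ifP => [_ ->//|_].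
by rewrite inE => /orP[->//|/set1P].
Qed.

Lemma step_new C s z : set0 \in C -> z \in dla_step C s -> z \notin C ->
  [/\ 0 < #|z|, s \in thru z & lv s #|z|.-1 \in C].
Proof.
move=> C0 zs zC; have zE := step_newP C0 zs zC; move: zE zs.
set h := find _ _ => zE zs.
have hh : has (fun j => walk_vertex s j \in C) (iota 0 n.+1).
  apply/hasP; exists n; rewrite ?mem_iota //=.
  by have -> : walk_vertex s n = set0 by apply/eqP; rewrite -cards_eq0 card_walk_vertex subnn.
have hn : h < n.+1 by move: hh; rewrite has_find size_iota.
have h0 : 0 < h.
  rewrite lt0n; apply/eqP => h0; move: zs; rewrite /dla_step -/h h0 eqxx.
  by rewrite (negbTE zC).
have hC : walk_vertex s h \in C by have := nth_find 0 hh; rewrite nth_iota.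
have cz : #|z| = n - h.-1 by rewrite zE card_walk_vertex.
split; first by rewrite cz; lia.
  by rewrite inE /lv cz subKn ?zE //; lia.
by rewrite /lv cz; have -> : n - (n - h.-1).-1 = h by lia.
Qed.

Definition run C (w : seq 'S_n) := foldl (@dla_step n) C w.

Lemma run_sub C w : C \subset run C w.
Proof.
elim: w C => //= s w IH C; apply: subset_trans (IH _); exact: step_sub.
Qed.

Lemma run_cat C u v : run C (u ++ v) = run (run C u) v.
Proof. exact: foldl_cat. Qed.

Lemma run_take_sub C w a b : a <= b -> run C (take a w) \subset run C (take b w).
Proof.
by move=> ab; rewrite -(subnKC ab) takeD run_cat; apply: run_sub.
Qed.

Lemma run_lv C w z : set0 \in C -> z \in run C w -> z \notin C ->
  exists2 s, s \in w & s \in thru z.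
Proof.
elim: w C => [|s w IH] C C0 /= zr zC; first by rewrite zr in zC.
have [zs|zs] := boolP (z \in dla_step C s).
  by exists s; rewrite ?mem_head //; have [] := step_new C0 zs zC.
have [|s' s'w s'z] := IH _ _ zr zs; last by exists s'; rewrite // inE s'w orbT.
by apply: (subsetP (step_sub C s)).
Qed.

(** An invariant of the process: the occupied levels form an initial interval, so an empty level M
    forces all higher levels to be empty. *)
Definition level_closed C :=
  forall z, z \in C -> 0 < #|z| -> exists2 y, y \in C & #|y| = #|z|.-1.

Lemma run_level_closed C w : set0 \in C -> level_closed C -> level_closed (run C w).
Proof.
elim: w C => //= s w IH C C0 cC; apply: IH; first exact: (subsetP (step_sub C s)).
move=> z zs z0; have sub := subsetP (step_sub C s).
have [zC|zC] := boolP (z \in C).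
  by have [y yC yz] := cC _ zC z0; exists y; rewrite ?sub.
have [_ _ lC] := step_new C0 zs zC; exists (lv s #|z|.-1); first exact: sub.
by rewrite card_lv //; have := leq_card_n z; lia.
Qed.

Lemma level_closed_empty C M : level_closed C ->
  (forall z, z \in C -> #|z| != M) -> forall z, z \in C -> #|z| < M.
Proof.
move=> cC CM z zC; rewrite ltnNge; apply/negP => Mz.
have [d] := ubnP (#|z| - M); elim: d z zC Mz => // d IH z zC Mz.
rewrite ltnS => zd; have zM := CM _ zC.
have [|y yC yz] := cC z zC; first by move/eqP: zM; lia.
by apply: (IH y) => //; rewrite yz; move/eqP: zM; lia.
Qed.

(** * The chance that a step occupies a given vertex *)

Definition blocked x C :=
  [set s in thru x | [exists j : 'I_n.+1, (#|x| < j) && (lv s j \in C)]].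

Definition low x C := [set y in C | (y \subset x) && (#|y|.+1 == #|x|)].

Definition clear_above x C := 4 * #|blocked x C| <= #|thru x|.

Definition supported x C := #|x| <= 2 * #|low x C|.

(** Opposite monotonicity to [supported]: being clear at the end of a time interval and supported at
    its start gives both throughout it. *)
Lemma clear_above_anti x C D : C \subset D -> clear_above x D -> clear_above x C.
Proof.
move=> CD; apply: leq_trans; rewrite leq_pmul2l // subset_leq_card //.
apply/subsetP => s; rewrite !inE => /andP[-> /existsP[j /andP[xj jC]]].
by apply/existsP; exists j; rewrite xj (subsetP CD).
Qed.

Lemma supported_mono x C D : C \subset D -> supported x C -> supported x D.
Proof.
move=> CD h; apply: leq_trans h _; rewrite leq_pmul2l // subset_leq_card //.
by apply/subsetP => s; rewrite !inE => /andP[/(subsetP CD)->].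
Qed.

Lemma card_lower_nbrs x : 0 < #|x| ->
  #|[set y : {set 'I_n} | (y \subset x) && (#|y|.+1 == #|x|)]| = #|x|.
Proof.
move=> x0; rewrite -[RHS]bin1 -bin_sub // -cards_draws; apply: eq_card => y.
by rewrite !inE; congr andb; apply/eqP/eqP; lia.
Qed.

(** Of the walks through x, at most a quarter are stopped above x and at most half go on to an
    unoccupied lower neighbour. The remaining quarter stops at x. *)
Lemma card_step_adds x C : x \notin C -> 0 < #|x| ->
  clear_above x C -> supported x C ->
  #|thru x| <= 4 * #|[set s | x \in dla_step C s]|.
Proof.
move=> xC x0 cl su; have xn := leq_card_n x.
pose down := [set y : {set 'I_n} | (y \subset x) && (#|y|.+1 == #|x|)].
pose bad := \bigcup_(y in down :\: C) (thru x :&: thru y).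
have sub : thru x \subset
    (blocked x C :|: bad) :|: [set s | x \in dla_step C s].
  apply/subsetP => s sx; rewrite in_setU in_setU.
  case: (boolP (s \in blocked x C)) => //= nb.
  case: (boolP (s \in bad)) => //= nbad; rewrite inE.
  have lx : #|lv s #|x|.-1| = #|x|.-1 by rewrite card_lv //; lia.
  apply: step_adds => //.
    apply: contraNT nbad => lC; apply/bigcupP; exists (lv s #|x|.-1).
      rewrite !inE lC lx prednK // eqxx andbT; apply: (sub_thru sx); lia.
    by rewrite in_setI sx lv_thru //; lia.
  move=> j /andP[]; rewrite leq_eqVlt => /orP[/eqP <- _|xj jn].
    by move: sx; rewrite inE => /eqP->.
  apply: contra nb => jC; rewrite inE sx; apply/existsP.
  by exists (Ordinal (jn : j < n.+1)); rewrite xj.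
(* Each lower neighbour is visited by a fraction [1 / #|x|] of the walks through x. *)
have c1 : #|bad| * #|x| <= #|down :\: C| * #|thru x|.
  apply: (@leq_trans ((\sum_(y in down :\: C) #|thru x :&: thru y|) * #|x|)).
    rewrite leq_mul2r; apply/orP; right; rewrite /bad; elim/big_rec2: _ => [|y a A _ h].
      by rewrite cards0.
    by rewrite (leq_trans (leq_card_setU _ _)) // leq_add2l.
  rewrite big_distrl -sum_nat_const /=; apply: leq_sum => y.
  rewrite !inE => /andP[_ /andP[yx /eqP cy]].
  by rewrite -(card_thru_down yx) -cy binSn.
have c2 : 2 * #|down :\: C| <= #|x|.
  have := cardsID C down; rewrite card_lower_nbrs //.
  have -> : down :&: C = low x C by apply/setP => y; rewrite !inE andbC.
  by move: su; rewrite /supported; move: #|low x C| #|down :\: C| #|x| => a b c; lia.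
have c3 := leq_trans (subset_leq_card sub) (leq_card_setU _ _).
have c4 : #|blocked x C :|: bad| <= #|blocked x C| + #|bad| := leq_card_setU _ _.
have c5 : 2 * #|bad| <= #|thru x|.
  rewrite -(leq_pmul2r x0) -mulnA (leq_trans (leq_mul (leqnn 2) c1)) //.
  by rewrite mulnA mulnC leq_mul.
move: cl c3 c4 c5; rewrite /clear_above.
move: #|thru x| #|_ :|: bad| #|blocked x C| #|bad| #|[set s | _]| => a b c d e; lia.
Qed.

Lemma card_thru_gt0 x : 0 < #|thru x|.
Proof. by have := fact_gt0 n; rewrite -(card_thru x) muln_gt0 => /andP[]. Qed.

Lemma card_perm_gt0 : 0 < #|{: 'S_n}|.
Proof. by rewrite card_Sn fact_gt0. Qed.

Local Open Scope ring_scope.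

Lemma frac_thru x : #|thru x|%:R / #|{: 'S_n}|%:R = ('C(n, #|x|)%:R)^-1 :> R.
Proof.
rewrite card_Sn -(card_thru x) natrM invfM mulrA divff ?mul1r //.
by rewrite pnatr_eq0 -lt0n card_thru_gt0.
Qed.

(** As long as Y is empty and clear, each step occupies some vertex of Y with probability at least
    [#|Y| / (4 * 'C(n, k))]; induction on t multiplies the survival factors. *)
Lemma Pr_empty_le (Y : {set {set 'I_n}}) k C t : set0 \in C -> (0 < k)%N ->
  (forall x, x \in Y -> #|x| = k /\ supported x C) ->
  Pr t (fun w => [forall x in Y, (x \notin run C w) && clear_above x (run C w)])
    <= exp (- (#|Y|%:R / (4 * 'C(n, k)%:R))) ^+ t.
Proof.
move=> C0 k0; elim: t C C0 => [|t IH] C C0 Yk.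
  by rewrite expr0 /Pr /= lern1 leq_b1.
set r := exp _ in IH *.
have sS := step_sub C.
have r0 : 0 <= r by apply: exp_ge0.
(* If a vertex of Y is already occupied or not clear, monotonicity makes the event impossible. *)
have [Ybad|Ygood] :=
  boolP [exists x in Y, ~~ ((x \notin C) && clear_above x C)].
  have [x xY xbad] := exists_inP Ybad.
  apply: le_trans (exprn_ge0 _ r0).
  rewrite -[0](Ex_cst card_perm_gt0 t.+1); apply: Ex_le; first exact: card_perm_gt0.
  move=> w; rewrite lern0 eqb0; apply: contra xbad => /forall_inP/(_ x xY)/andP[h1 h2].
  by rewrite (contra _ h1) ?(clear_above_anti _ h2) ?run_sub //;
     apply: (subsetP (run_sub C w)).
have {}Ygood x : x \in Y -> x \notin C /\ clear_above x C.
  by move=> xY; move: Ygood; rewrite negb_exists_in => /forall_inP/(_ x xY);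
     rewrite negbK => /andP.
pose A := [set s | [exists x in Y, x \in dla_step C s]].
apply: (@le_trans _ _ (avg (fun s => r ^+ t * (1 - (s \in A)%:R)))).
  apply: avg_le; first exact: card_perm_gt0.
  move=> s; case: (boolP (s \in A)) => sA.
    rewrite subrr mulr0 -[0](Ex_cst card_perm_gt0 t).
    apply: Ex_le; first exact: card_perm_gt0.
    move: sA; rewrite inE => /exists_inP[x xY xs] w.
    rewrite lern0 eqb0; apply/negP => /forall_inP/(_ x xY)/andP[+ _].
    by rewrite /= (subsetP (run_sub _ w)).
  rewrite subr0 mulr1; apply: IH; first exact: (subsetP (sS s)).
  by move=> x xY; have [? h] := Yk x xY; split=> //; apply: supported_mono h.
rewrite avgZ exprSr ler_wpM2l ?exprn_ge0 //.
apply: le_trans (exp_ge1Dx _).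
rewrite avgD avg_cst ?card_perm_gt0 // lerD2l.
rewrite (eq_avg (g := fun s => (-1) * (s \in A)%:R)); last by move=> s; rewrite mulN1r.
rewrite avgZ mulN1r lerN2 avg_pred.
have -> : #|[pred s | s \in A]| = #|A| by apply: eq_card.
(* One step adds one vertex only, so the probabilities add up exactly over Y. *)
have cA : (\sum_(x in Y) #|[set s | x \in dla_step C s]| = #|A|)%N.
  under eq_bigr => x _ do rewrite -sum1_card big_mkcond.
  rewrite exchange_big -sum1_card [RHS]big_mkcond; apply: eq_bigr => s _.
  under eq_bigr => x _ do rewrite inE.
  rewrite inE; case: ifPn => [/exists_inP[x xY xs]|].
    rewrite (bigD1 x) //= xs big1 ?addn0 // => y /andP[yY yx]; case: ifP => // ys.
    have [xC _] := Ygood x xY; have [yC _] := Ygood y yY.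
    by move: yx; rewrite (step_newP C0 ys yC) -(step_newP C0 xs xC) eqxx.
  rewrite negb_exists_in => /forall_inP h; apply: big1 => x xY.
  by rewrite (negbTE (h x xY)).
rewrite ler_pdivlMr ?ltr0n ?card_perm_gt0 //.
have h1 : #|Y|%:R / (4 * 'C(n, k)%:R) * #|{: 'S_n}|%:R =
    \sum_(x in Y) #|thru x|%:R / 4 :> R.
  rewrite (eq_bigr (fun=> #|{: 'S_n}|%:R / (4 * 'C(n, k)%:R))); last first.
    move=> x xY; have [xk _] := Yk x xY; rewrite invfM -xk -frac_thru.
    have : #|{: 'S_n}|%:R != 0 :> R by rewrite pnatr_eq0 -lt0n card_perm_gt0.
    by move=> ?; field.
  by rewrite sumr_const -[RHS]mulr_natl mulrA mulrAC.
rewrite h1 -cA natr_sum; apply: ler_sum => x xY.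
have [xk su] := Yk x xY; have [xC cl] := Ygood x xY.
have := card_step_adds xC _ cl su; rewrite xk => /(_ k0).
rewrite -(ler_nat R) natrM; lra.
Qed.

End Growth.

(** * Occupation above a level *)

Section Bounds.

Variable n : nat.
Implicit Types (s : 'S_n) (x y z : {set 'I_n}) (C : {set {set 'I_n}}) (w : seq 'S_n).

Let perm_gt0 := card_perm_gt0 n.

Lemma avg_thru x : avg (fun s => (s \in thru x)%:R) = ('C(n, #|x|)%:R)^-1.
Proof. by rewrite -frac_thru avg_pred. Qed.

Lemma avg_lv_in (A : {set {set 'I_n}}) j : (j <= n)%N ->
  (forall z, z \in A -> #|z| = j) ->
  avg (fun s => (lv s j \in A)%:R) = #|A|%:R / 'C(n, j)%:R.
Proof.
move=> jn Aj.
rewrite (eq_avg (g := fun s => \sum_(z in A) (s \in thru z)%:R)); last first.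
  move=> s; have [lA|lA] := boolP (lv s j \in A).
    rewrite (bigD1 (lv s j)) //= lv_thru // big1 ?addr0 // => z /andP[zA zl].
    by rewrite inE (Aj _ zA) eq_sym (negbTE zl).
  rewrite big1 // => z zA; rewrite inE (Aj _ zA).
  by case: eqP lA => // ->; rewrite zA.
rewrite avg_sum (eq_bigr (fun=> ('C(n, j)%:R)^-1)); last first.
  by move=> z zA; rewrite avg_thru (Aj _ zA).
by rewrite sumr_const mulr_natl.
Qed.

(** A walk sticks on level j+1 only if its own vertex on level j is occupied, and then it adds a
    single vertex. *)
Lemma level_count_step C s j : set0 \in C ->
  (level_count (dla_step C s) j.+1 <= level_count C j.+1 + (lv s j \in C))%N.
Proof.
move=> C0; rewrite /level_count.
have new z : z \in dla_step C s -> #|z| = j.+1 -> z \notin C ->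
    lv s j \in C /\ z = lv s j.+1.
  move=> zs zj zC; have [_ + +] := step_new C0 zs zC.
  by rewrite inE zj => /eqP -> ->.
have [lC|lC] := boolP (lv s j \in C).
  apply: (@leq_trans #|lv s j.+1 |: [set x in C | #|x| == j.+1]|); last first.
    by rewrite (leq_trans (leq_card_setU _ _)) // cards1 addnC.
  apply/subset_leq_card/subsetP => z; rewrite !inE => /andP[zs /eqP zj].
  have [zC|zC] := boolP (z \in C); first by rewrite zj eqxx orbT.
  by have [_ <-] := new z zs zj zC; rewrite eqxx.
rewrite addn0; apply/subset_leq_card/subsetP => z; rewrite !inE => /andP[zs /eqP zj].
rewrite zj eqxx andbT; apply: contraNT lC => zC; by have [] := new z zs zj zC.
Qed.

Lemma level_count_le C j : (level_count C j <= 'C(n, j))%N.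
Proof.
rewrite -[n in X in (_ <= X)%N]card_ord -cardsT -cards_draws.
by apply/subset_leq_card/subsetP => z; rewrite !inE subsetT => /andP[_ ->].
Qed.

Lemma clusterE w : cluster_after w = run [set set0] w.
Proof. by []. Qed.

Lemma set0_cluster w : set0 \in cluster_after w.
Proof. by apply: (subsetP (run_sub _ w)); rewrite inE. Qed.

(** One step enlarges level j+1 by, on average, at most the expected population of level j over
    ['C(n, j)]. Summed over at most T steps, each level gains a factor 1/20. *)
Lemma Ex_level T j0 i : (j0 + i <= n)%N ->
  (forall j, (j0 <= j < j0 + i)%N -> (20 * T <= 'C(n, j))%N) ->
  forall t, (t <= T)%N ->
  Ex t (fun w => (level_count (cluster_after w) (j0 + i))%:R) <=
    'C(n, j0)%:R * (20^-1) ^+ i.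
Proof.
elim: i => [|i IH] jn TC t tT.
  rewrite addn0 mulr1 -[X in _ <= X](Ex_cst perm_gt0 t).
  by apply: Ex_le => // w; rewrite ler_nat level_count_le.
set B := 'C(n, j0)%:R * (20^-1) ^+ i : R.
have {}IH u : (u <= T)%N ->
    Ex u (fun w => (level_count (cluster_after w) (j0 + i))%:R) <= B.
  apply: IH; first lia.
  by move=> j hj; apply: TC; lia.
have B0 : 0 <= B by rewrite mulr_ge0 ?exprn_ge0 ?invr_ge0 ?ler0n.
set N := 'C(n, j0 + i)%:R : R.
have N0 : 0 < N by rewrite ltr0n bin_gt0; lia.
have step u : (u <= T)%N ->
    Ex u (fun w => (level_count (cluster_after w) (j0 + i.+1))%:R) <= u%:R * (B / N).
  elim: u => [_|u IHu uT].
    rewrite mul0r /= lern0 /level_count cards_eq0; apply/eqP/setP => z.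
    by rewrite !inE; case: eqP => // ->; rewrite cards0 addnS.
  rewrite Ex_rcons //.
  apply: (@le_trans _ _ (Ex u (fun w =>
     (level_count (cluster_after w) (j0 + i.+1))%:R +
     N^-1 * (level_count (cluster_after w) (j0 + i))%:R))).
    apply: Ex_le => // w.
    rewrite mulrC /N -avg_lv_in; [|lia|by move=> z; rewrite inE => /andP[_ /eqP]].
    rewrite -[X in _ <= X + _](avg_cst perm_gt0) -avgD; apply: avg_le => // s.
    rewrite -natrD ler_nat addnS clusterE /run foldl_rcons -/(run _ _) -clusterE.
    apply: leq_trans (level_count_step _ _ (set0_cluster w)) _.
    by rewrite leq_add2l inE card_lv ?eqxx ?andbT //; lia.
  rewrite ExD ExZ -natr1 mulrDl mul1r lerD ?IHu ?(ltnW uT) //.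
  by rewrite mulrC ler_pM2r ?invr_gt0 // IH // ltnW.
apply: le_trans (step t tT) _.
have -> : 'C(n, j0)%:R * 20^-1 ^+ i.+1 = B * 20^-1 by rewrite exprSr mulrA.
rewrite mulrCA ler_wpM2l // ler_pdivrMr //.
have : (20 * T)%:R <= N by rewrite ler_nat; apply: TC; lia.
have : t%:R <= T%:R :> R by rewrite ler_nat.
by rewrite natrM; lra.
Qed.

Lemma Pr_level T j0 i : (j0 + i <= n)%N ->
  (forall j, (j0 <= j < j0 + i)%N -> (20 * T <= 'C(n, j))%N) ->
  Pr T (fun w => [exists z in cluster_after w, #|z| == j0 + i]%N) <=
    'C(n, j0)%:R * (20^-1) ^+ i.
Proof.
move=> h1 h2; apply: le_trans (Ex_level h1 h2 (leqnn T)).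
rewrite -[X in X <= _]mul1r; apply: Pr_markov => // w.
move=> /exists_inP[z zC zj]; rewrite ler1n /level_count lt0n cards_eq0.
by apply/set0Pn; exists z; rewrite inE zC.
Qed.

(** * Concentration of the blocked fraction above a vertex *)

Lemma exp_sum (w : seq 'S_n) (f : 'S_n -> R) :
  exp (\sum_(s <- w) f s) = \prod_(s <- w) exp (f s).
Proof.
elim: w => [|s w IH]; first by rewrite !big_nil exp_0.
by rewrite !big_cons exp_add IH.
Qed.

(* Exponential Markov inequality with [1 + u] in place of [exp u]: on [0, 1]
   it lies between [exp (u / 2)] and [exp u]. *)
Lemma Pr_chernoff (f : 'S_n -> R) (a mu tau : R) T : 0 < a ->
  (forall s, 0 <= f s <= a) -> T%:R * avg f <= mu ->
  Pr T (fun w => tau < \sum_(s <- w) f s) <= exp ((mu - tau / 2) / a).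
Proof.
move=> a0 fa fmu.
have u01 s : 0 <= f s / a <= 1.
  have /andP[f0 fle] := fa s.
  by rewrite divr_ge0 ?(ltW a0) //= ler_pdivrMr // mul1r.
have hM : exp (tau / 2 / a) * Pr T (fun w => tau < \sum_(s <- w) f s) <=
    Ex T (fun w => \prod_(s <- w) (1 + f s / a)).
  apply: Pr_markov => // w.
    by apply: prodr_ge0 => s _; have /andP[? _] := u01 s; rewrite addr_ge0.
  move=> tw; apply: (@le_trans _ _ (\prod_(s <- w) exp (f s / a / 2))).
    rewrite -exp_sum; apply: exp_le; rewrite -mulr_suml -mulr_suml.
    by rewrite mulrAC ler_pM2r ?invr_gt0 // ler_pM2r ?invr_gt0 // ltW.
  by apply: ler_prod => s _; rewrite exp_ge0 exp_half.
move: hM; rewrite (Ex_prod perm_gt0 T (fun s => 1 + f s / a)) avgD avg_cst // => hM.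
have avga : avg (fun s => f s / a) = avg f / a.
  rewrite -[RHS]mulrC -avgZ; by apply: eq_avg => s; rewrite mulrC.
have h2 : (1 + avg (fun s => f s / a)) ^+ T <= exp (mu / a).
  have fa0 : 0 <= avg f.
    by rewrite -[0](avg_cst perm_gt0); apply: avg_le => // s; have /andP[] := fa s.
  apply: (@le_trans _ _ (exp (avg f / a) ^+ T)).
    have a0' := ltW a0.
    rewrite avga; apply: lerXn2r; last exact: exp_ge1Dx; rewrite nnegrE ?exp_ge0 //.
    by rewrite addr_ge0 // divr_ge0.
  rewrite exp_mulrn; apply: exp_le; rewrite mulrA ler_pM2r ?invr_gt0 //.
have -> : (mu - tau / 2) / a = mu / a + - (tau / 2 / a) by field; rewrite gt_eqF.
rewrite exp_add -(ler_pM2l (_ : 0 < exp (tau / 2 / a))); last exact/RltP/exp_pos.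
apply: le_trans hM (le_trans h2 _).
by rewrite mulrCA -exp_add subrr exp_0 mulr1.
Qed.

(* Blocked fraction of the walks through x contributed by one walk s: the
   vertex [lv s j] stops a fraction 1/'C(n - k, j - k) of them. *)
Definition shade M x s : R :=
  \sum_(#|x|.+1 <= j < M) (x \subset lv s j)%:R / 'C(n - #|x|, j - #|x|)%:R.

Lemma shade_ge0 M x s : 0 <= shade M x s.
Proof. by apply: sumr_ge0 => j _; rewrite divr_ge0. Qed.

(** The weights decay geometrically from the one of level [#|x| + 1], which is [1 / (n - #|x|)]. *)
Lemma shade_le M x s : (3 * M <= n)%N -> (#|x|.+1 < M)%N ->
  shade M x s <= 2 / (n - #|x|)%:R.
Proof.
move=> Mn xM.
apply: (@le_trans _ _ (\sum_(#|x|.+1 <= j < M) ('C(n - #|x|, j - #|x|)%:R)^-1)).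
  apply: ler_sum => j _; rewrite ler_piMl ?invr_ge0 //; by case: (_ \subset _).
have -> : (n - #|x|)%:R = 'C(n - #|x|, #|x|.+1 - #|x|)%:R :> R by rewrite subSnn bin1.
apply: (sum_inv_geom (f := fun j => 'C(n - #|x|, j - #|x|)%:R)) => //.
  by move=> j hj; rewrite ltr0n bin_gt0; lia.
move=> j ja jM; rewrite -natrM ler_nat subSn; last lia.
by apply: bin_double; lia.
Qed.

Lemma avg_sub_lv x j : (#|x| <= j <= n)%N ->
  avg (fun s => (x \subset lv s j)%:R) = 'C(n - #|x|, j - #|x|)%:R / 'C(n, j)%:R.
Proof.
move=> /andP[xj jn]; pose A := [set z : {set 'I_n} | (x \subset z) && (#|z| == j)].
have -> : 'C(n - #|x|, j - #|x|) = #|A|.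
  rewrite card_supersets // -bin_sub; last exact: leq_sub2r.
  by congr 'C(_, _); lia.
rewrite -avg_lv_in //; last by move=> z; rewrite inE => /andP[_ /eqP].
by apply: eq_avg => s; rewrite inE card_lv // eqxx andbT.
Qed.

(** The number of supersets of x on level j cancels the weight, leaving [1 / 'C(n, j)]. *)
Lemma avg_shade M x : (M <= n)%N ->
  avg (shade M x) = \sum_(#|x|.+1 <= j < M) ('C(n, j)%:R)^-1.
Proof.
move=> Mn; rewrite avg_sum big_nat_cond [RHS]big_nat_cond; apply: eq_bigr => j.
rewrite andbT => /andP[xj jM].
rewrite (eq_avg (g := fun s => ('C(n - #|x|, j - #|x|)%:R)^-1 * (x \subset lv s j)%:R));
  last by move=> s; rewrite mulrC.
rewrite avgZ avg_sub_lv; last by lia.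
by rewrite mulKf // pnatr_eq0 -lt0n bin_gt0; lia.
Qed.

(** Chernoff with summands at most [2 / (n - #|x|)], total mean at most 1/10 and threshold 1/4: the
    exponent is (1/10 - 1/8) divided by that size. *)
Lemma Pr_shade M x T : (3 * M <= n)%N -> (#|x|.+1 < M)%N ->
  (20 * T <= 'C(n, #|x|.+1))%N ->
  Pr T (fun w => 4^-1 < \sum_(s <- w) shade M x s) <=
    exp (- ((n - #|x|)%:R / 80)).
Proof.
move=> Mn xM TC.
have nx0 : 0 < (n - #|x|)%:R :> R by rewrite ltr0n; lia.
have C0 : 0 < 'C(n, #|x|.+1)%:R :> R by rewrite ltr0n bin_gt0; lia.
have := @Pr_chernoff (shade M x) (2 / (n - #|x|)%:R) 10^-1 4^-1 T.
have -> : (10^-1 - 4^-1 / 2) / (2 / (n - #|x|)%:R) = - ((n - #|x|)%:R / 80) :> R.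
  by field; rewrite gt_eqF.
apply.
- by rewrite divr_gt0.
- by move=> s; rewrite shade_ge0 shade_le.
- rewrite avg_shade; last lia.
  apply: (@le_trans _ _ (T%:R * (2 / 'C(n, #|x|.+1)%:R))).
    by rewrite ler_wpM2l // sum_bin_inv //; lia.
  rewrite mulrA ler_pdivrMr //.
  by move: TC; rewrite -(ler_nat R) natrM; lra.
Qed.

(** Every occupied vertex of level j was visited by some walk of w, and a walk visits only one
    vertex of that level. *)
Lemma level_above_count w x j : (#|x| < j <= n)%N ->
  (#|[set z in cluster_after w | (x \subset z) && (#|z| == j)]| <=
   count (fun s => x \subset lv s j) w)%N.
Proof.
move=> /andP[xj jn]; rewrite -size_filter cardE -(size_map (fun s => lv s j)).
apply: uniq_leq_size; first exact: enum_uniq.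
move=> z; rewrite mem_enum !inE => /andP[zC /andP[xz /eqP zj]].
have [||s sw] := run_lv _ (zC : z \in run [set set0] w).
- by rewrite inE.
- by rewrite inE -cards_eq0 zj; lia.
rewrite inE zj => /eqP sz; apply/mapP; exists s => //.
by rewrite mem_filter sw sz xz.
Qed.

(** Union bound over the occupied vertices above x, each stopping a known fraction of the walks
    through x; their number on each level is bounded by that of the walks of w lying above x
    there. *)
Lemma clear_above_shade M w x : (M <= n)%N ->
  (forall z, z \in cluster_after w -> (#|z| < M)%N) ->
  \sum_(s <- w) shade M x s <= 4^-1 -> clear_above x (cluster_after w).
Proof.
move=> Mn top sh; set C := cluster_after w in top *.
pose A j := [set z in C | (x \subset z) && (#|z| == j)].
have h1 : (#|blocked x C| <=
    \sum_(#|x|.+1 <= j < M) \sum_(z in A j) #|thru x :&: thru z|)%N.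
  apply: (@leq_trans (\sum_(s in thru x) \sum_(#|x|.+1 <= j < M)
     \sum_(z in A j) (s \in thru z))).
    rewrite -sum1_card big_mkcond [X in (_ <= X)%N]big_mkcond; apply: leq_sum => s _.
    rewrite inE; case: (boolP (s \in thru x)) => //= sx.
    case: existsP => // -[j /andP[xj jC]].
    have jn : (j <= n)%N by rewrite -ltnS.
    have jM : (j < M)%N by have := top _ jC; rewrite card_lv.
    rewrite (bigD1_seq (nat_of_ord j)) ?iota_uniq ?mem_index_iota ?xj //=.
    rewrite (bigD1 (lv s j)) /=; last first.
      by rewrite !inE jC card_lv // eqxx (thru_sub sx) // ltnW.
    by rewrite lv_thru.
  rewrite exchange_big /=; apply: leq_sum => j _.
  rewrite exchange_big /=; apply: leq_sum => z _.
  rewrite -sum1_card big_mkcond [X in (_ <= X)%N]big_mkcond /=.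
  apply: leq_sum => s _.
  by rewrite in_setI; case: (s \in thru x) => //=; case: (s \in thru z).
have h2 : (#|blocked x C|)%:R <= #|thru x|%:R * \sum_(s <- w) shade M x s :> R.
  move: h1; rewrite -(ler_nat R) natr_sum => /le_trans-> //.
  rewrite exchange_big mulr_sumr big_nat_cond [X in _ <= X]big_nat_cond.
  apply: ler_sum => j; rewrite andbT => /andP[xj jM].
  have jn : (j <= n)%N by lia.
  set b := 'C(n - #|x|, j - #|x|)%:R : R.
  have b0 : 0 < b by rewrite ltr0n bin_gt0; lia.
  rewrite natr_sum (eq_bigr (fun=> #|thru x|%:R / b)); last first.
    move=> z; rewrite !inE => /andP[_ /andP[xz /eqP zj]].
    by rewrite -(card_thru_up xz) natrM zj mulfK // gt_eqF.
  rewrite sumr_const -[_ *+ _]mulr_natr -mulrA ler_wpM2l // mulrC -mulr_suml.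
  rewrite ler_pM2r ?invr_gt0 // -natr_sum ler_nat.
  apply: leq_trans (level_above_count _ _) _; first by rewrite xj.
  by rewrite -sum1_count big_mkcond.
rewrite /clear_above -(ler_nat R) natrM.
have t0 : 0 <= #|thru x|%:R :> R by [].
have : #|thru x|%:R * \sum_(s <- w) shade M x s <= #|thru x|%:R * 4^-1.
  exact: ler_wpM2l.
lra.
Qed.

End Bounds.

(** * The union bound *)

Section UnionBound.

Variable n : nat.
Implicit Types (s : 'S_n) (x y z : {set 'I_n}) (Y : {set {set 'I_n}}) (w : seq 'S_n).

Let perm_gt0 := card_perm_gt0 n.

Definition layer k := [set x : {set 'I_n} | #|x| == k].

Definition lower z := [set y : {set 'I_n} | (y \subset z) && (#|y|.+1 == #|z|)].

(* By this time level k is nearly full, while only a fraction 1/20 of level k+1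
   can be occupied. *)
Definition fill_time k := ('C(n, k.+1) %/ 20)%N.

Definition cluster_at k w := cluster_after (take (fill_time k) w).

Definition stuck k Y w := [forall x in Y,
  [&& x \notin cluster_at k w, clear_above x (cluster_at k w)
    & supported x (cluster_at k.-1 w)]].

(** The exponent that each vertex of Y contributes over the time interval of level k. *)
Definition rate k : R := (fill_time k - fill_time k.-1)%N%:R / (4 * 'C(n, k)%:R).

Lemma card_layer k : #|layer k| = 'C(n, k).
Proof.
rewrite -[n in RHS]card_ord -cardsT -cards_draws.
by apply: eq_card => z; rewrite !inE subsetT.
Qed.

Lemma leq_fill_time M j k : (3 * M <= n)%N -> (k < M)%N -> (j <= k)%N ->
  (fill_time j <= fill_time k)%N.
Proof. by move=> Mn kM jk; apply: leq_div2r; apply: bin_incr; lia. Qed.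

Lemma fill_time_le k : (fill_time k <= 2 ^ n)%N.
Proof.
rewrite (leq_trans (leq_div _ _)) // -card_layer -[n in (_ <= 2 ^ n)%N]card_ord -cardsT.
by rewrite -card_powerset subset_leq_card //; apply/subsetP => x; rewrite !inE subsetT.
Qed.

(** Condition on the walks up to [fill_time k.-1]: either some vertex of Y is unsupported and the
    event is impossible, or [Pr_empty_le] applies to the remaining walks. *)
Lemma Pr_stuck M k Y : (3 * M <= n)%N -> (0 < k < M)%N -> Y \subset layer k ->
  Pr (2 ^ n) (stuck k Y) <= exp (- (#|Y|%:R * rate k)).
Proof.
move=> Mn /andP[k0 kM] Yk.
have le_t : (fill_time k.-1 <= fill_time k)%N by apply: (leq_fill_time Mn kM); lia.
pose P u := [forall x in Y, [&& x \notin cluster_after u, clear_above x (cluster_after u)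
    & supported x (cluster_after (take (fill_time k.-1) u))]].
have -> : Pr (2 ^ n) (stuck k Y) = Pr (fill_time k) P.
  rewrite -(Pr_take perm_gt0 P (fill_time_le k)); apply: eq_Ex => // w.
  by rewrite /P take_takel.
rewrite /Pr -(subnKC le_t) Ex_cat.
set d := (_ - _)%N; set r := exp _.
rewrite -[r](Ex_cst perm_gt0 (fill_time k.-1)); apply: Ex_le_size => // u su.
have r0 : 0 <= r by apply: exp_ge0.
have [/forall_inP sup|] := boolP [forall x in Y, supported x (cluster_after u)]; last first.
  rewrite negb_forall_in => /exists_inP[x xY nsup].
  rewrite -[r](Ex_cst perm_gt0 d); apply: Ex_le => // v.
  rewrite (_ : P _ = false) //; apply/negP => /forall_inP/(_ x xY)/and3P[_ _].
  by rewrite take_size_cat // (negbTE nsup).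
have -> : r = exp (- (#|Y|%:R / (4 * 'C(n, k)%:R))) ^+ d.
  by rewrite exp_mulrn /r /rate; congr exp; rewrite mulrN mulrCA.
apply: le_trans (Pr_empty_le _ (set0_cluster u) k0 _); last first.
  by move=> x xY; split; [have := subsetP Yk x xY; rewrite inE => /eqP|apply: sup].
apply: Pr_le => // v /forall_inP h; apply/forall_inP => x /h /and3P[].
by rewrite clusterE run_cat -clusterE => -> ->.
Qed.

(** * The bad events, what their absence implies, and their probability *)

Definition escape M q w := [exists z in cluster_at q w, #|z| == M].

Definition shaded M k w :=
  [exists x in layer k, 4^-1 < \sum_(s <- take (fill_time k) w) shade M x s].

(** Here [lower z] has k+1 elements, so [k < 2 * #|Y|] means that Y is at least half of it. *)
Definition hole k w := [exists z in layer k.+1,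
  [exists Y in [pred Y : {set {set 'I_n}} | (Y \subset lower z) && (k < 2 * #|Y|)%N], stuck k Y w]].

Definition sparse m k w :=
  [exists Y in [pred Y : {set {set 'I_n}} | (Y \subset layer k) && (#|Y| == m k)],
     stuck k Y w].

Definition bad M q m w := escape M q w ||
  has (fun k => shaded M k w || (hole k w || sparse m k w)) (iota 1 q).

Lemma cluster_at_sub j k w : (fill_time j <= fill_time k)%N ->
  cluster_at j w \subset cluster_at k w.
Proof. exact: run_take_sub. Qed.

(** Level M is empty at the latest time, so earlier clusters lie below M and truncating [shade] at M
    loses nothing. *)
Lemma clear_above_at M q m w k x : (3 * M <= n)%N -> (q.+1 < M)%N ->
  ~~ bad M q m w -> (0 < k <= q)%N -> x \in layer k -> clear_above x (cluster_at k w).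
Proof.
move=> Mn qM; rewrite negb_or => /andP[nesc /hasPn nb] /andP[k0 kq] xk.
have Mn' : (M <= n)%N by lia.
have := nb k; rewrite mem_iota => /(_ _)/norP[]; first by lia.
rewrite negb_exists_in => /forall_inP/(_ x xk); rewrite -leNgt => sh _.
apply: (clear_above_shade Mn' _ sh).
have top : forall z, z \in cluster_at q w -> (#|z| < M)%N.
  apply: level_closed_empty.
    by apply: run_level_closed; rewrite ?inE // => z; rewrite inE => /eqP->; rewrite cards0.
  by move=> z zC; move: nesc; rewrite negb_exists_in => /forall_inP/(_ z zC).
move=> z zC; apply: top; move: z zC; apply/subsetP/cluster_at_sub.
by apply: (leq_fill_time Mn) => //; lia.
Qed.

(** Induction on the level. The unoccupied lower neighbours of an unsupported vertex are clear and,
    by induction, supported; they would form a [hole]. At the bottom, the only lower neighbour of a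
    singleton is the origin. *)
Lemma supported_at M q m w k : (3 * M <= n)%N -> (q.+1 < M)%N ->
  ~~ bad M q m w -> (k <= q)%N ->
  forall z, z \in layer k.+1 -> supported z (cluster_at k w).
Proof.
move=> Mn qM nbad; elim: k => [|k IH] kq z; rewrite inE => /eqP zk.
  rewrite /supported zk; have : set0 \in low z (cluster_at 0 w).
    by rewrite inE set0_cluster sub0set cards0 zk.
  by move=> h; rewrite muln_gt0 /= lt0n cards_eq0; apply/set0Pn; exists set0.
rewrite /supported leqNgt; apply/negP => few.
have := nbad; rewrite negb_or => /andP[_ /hasPn /(_ k.+1)].
rewrite mem_iota => /(_ _)/norP[]; first by lia.
move=> _ /norP[+ _]; apply/negP; rewrite negbK.
apply/exists_inP; exists z; first by rewrite inE zk.
have cl : #|lower z| = k.+2 by rewrite card_lower_nbrs zk.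
have lowE : lower z :&: cluster_at k.+1 w = low z (cluster_at k.+1 w).
  by apply/setP => y; rewrite !inE andbC.
apply/exists_inP; exists (lower z :\: cluster_at k.+1 w).
  rewrite inE subsetDl /=; have := cardsID (cluster_at k.+1 w) (lower z).
  rewrite cl lowE; move: few; rewrite zk.
  move: #|low _ _| #|_ :\: _| => a b; lia.
apply/forall_inP => x; rewrite in_setD => /andP[xC].
rewrite inE zk eqSS => /andP[xz xk]; have xl : x \in layer k.+1 by rewrite inE.
rewrite xC IH //; last lia.
by rewrite andbT (clear_above_at Mn qM nbad) //; lia.
Qed.

(** Any [m k] vertices missing from level k would be clear and supported, hence a witness of
    [sparse]. Level 0 holds only the origin. *)
Lemma level_count_good M q m w k : (3 * M <= n)%N -> (q.+1 < M)%N ->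
  (forall k, 0 < m k)%N -> ~~ bad M q m w -> (k <= q)%N ->
  ('C(n, k) < level_count (cluster_after w) k + m k)%N.
Proof.
move=> Mn qM m0 nbad kq; case: k kq => [|k] kq.
  have : (0 < level_count (cluster_after w) 0)%N.
    rewrite lt0n cards_eq0; apply/set0Pn.
    by exists set0; rewrite inE set0_cluster cards0.
  by rewrite bin0; have := m0 0%N; lia.
rewrite ltnNge; apply/negP => few.
have subC : cluster_at k.+1 w \subset cluster_after w.
  by rewrite -{2}[w](cat_take_drop (fill_time k.+1)) clusterE run_cat run_sub.
pose E := layer k.+1 :\: cluster_at k.+1 w.
have cE : (m k.+1 <= #|E|)%N.
  have := cardsID (cluster_at k.+1 w) (layer k.+1); rewrite card_layer -/E.
  have : (#|layer k.+1 :&: cluster_at k.+1 w| <= level_count (cluster_after w) k.+1)%N.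
    apply/subset_leq_card/subsetP => x; rewrite !inE => /andP[-> /(subsetP subC)->].
    by [].
  by move: few; move: #|_ :&: _| #|E| => a b; lia.
have [Y YE cY] : exists2 Y : {set {set 'I_n}}, Y \subset E & #|Y| = m k.+1.
  have : (0 < 'C(#|E|, m k.+1))%N by rewrite bin_gt0.
  rewrite -cards_draws lt0n cards_eq0 => /set0Pn[Y]; rewrite inE => /andP[? /eqP ?].
  by exists Y.
have := nbad; rewrite negb_or => /andP[_ /hasPn /(_ k.+1)].
rewrite mem_iota => /(_ _)/norP[]; first by lia.
move=> _ /norP[_]; apply/negP; rewrite negbK.
apply/exists_inP; exists Y.
  by rewrite inE cY eqxx andbT (subset_trans YE) // subsetDl.
apply/forall_inP => x /(subsetP YE); rewrite in_setD => /andP[xC xk].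
rewrite xC (clear_above_at Mn qM nbad) ?(supported_at Mn qM nbad) //=; lia.
Qed.

Lemma Pr_bad M q m : (3 * M <= n)%N -> (q.+1 < M)%N ->
  Pr (2 ^ n) (bad M q m) <= 'C(n, q.+1)%:R * (20^-1) ^+ (M - q.+1) +
   \sum_(1 <= k < q.+1) ('C(n, k)%:R * exp (- ((n - k)%:R / 80)) +
     ('C(n, k.+1)%:R * 2 ^+ k.+1 * exp (- (k.+1%:R / 2 * rate k)) +
      'C('C(n, k), m k)%:R * exp (- ((m k)%:R * rate k)))).
Proof.
move=> Mn qM; have Mn' : (M <= n)%N by lia.
have T20 k : (20 * fill_time k <= 'C(n, k.+1))%N by rewrite mulnC leq_trunc_div.
apply: le_trans (Pr_or _ _ _ _) _ => //; apply: lerD.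
  rewrite (Pr_take perm_gt0 (fun w => [exists z in cluster_after w, #|z| == M]))
    ?fill_time_le //.
  have := @Pr_level n (fill_time q) q.+1 (M - q.+1).
  rewrite subnKC; last by lia.
  apply=> // j /andP[qj jM]; apply: leq_trans (T20 q) _; apply: bin_incr; lia.
apply: le_trans (Pr_has _ _ _ _) _ => //.
rewrite /index_iota subn1 /= big_seq [X in _ <= X]big_seq; apply: ler_sum => k.
rewrite mem_iota => kq.
have rate0 : 0 <= rate k by rewrite divr_ge0 ?mulr_ge0.
apply: le_trans (Pr_or _ _ _ _) _ => //; apply: lerD.
  apply: le_trans (Pr_exists _ _ _ _) _ => //.
  apply: (@le_trans _ _ (\sum_(x in layer k) exp (- ((n - k)%:R / 80)))).
    apply: ler_sum => x; rewrite inE => /eqP xk.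
    rewrite (Pr_take perm_gt0 (fun w => 4^-1 < \sum_(s <- w) shade M x s))
      ?fill_time_le //.
    by rewrite -{2}xk; apply: Pr_shade => //; rewrite xk ?T20 //; lia.
  by rewrite sumr_const card_layer [leRHS]mulr_natl.
apply: le_trans (Pr_or _ _ _ _) _ => //; apply: lerD.
  apply: le_trans (Pr_exists _ _ _ _) _ => //.
  apply: (@le_trans _ _ (\sum_(z in layer k.+1)
      (2 ^+ k.+1 * exp (- (k.+1%:R / 2 * rate k))))); last first.
    by rewrite sumr_const card_layer -[leRHS]mulrA [leRHS]mulr_natl.
  apply: ler_sum => z; rewrite inE => /eqP zk.
  apply: le_trans (Pr_exists _ _ _ _) _ => //.
  have cl : #|lower z| = k.+1 by rewrite card_lower_nbrs zk.
  (* The choice of Y costs at most the number [2 ^ k.+1] of all subsets of [lower z]. *)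
  apply: (@le_trans _ _ (\sum_(Y in powerset (lower z))
      exp (- (k.+1%:R / 2 * rate k)))); last first.
    by rewrite sumr_const card_powerset cl -natrX [leRHS]mulr_natl.
  rewrite big_mkcond [X in _ <= X]big_mkcond; apply: ler_sum => Y _ /=.
  rewrite !inE; case: ifP => [/andP[Yz kY]|_]; last by case: ifP => // _; apply: exp_ge0.
  rewrite Yz; apply: le_trans (Pr_stuck Mn _ _) _; first by lia.
    apply/subsetP => x /(subsetP Yz); rewrite !inE zk eqSS => /andP[_ ->].
    by [].
  apply: exp_le; rewrite lerN2 ler_wpM2r //.
  by move: kY; rewrite -(ler_nat R) natrM; lra.
apply: le_trans (Pr_exists _ _ _ _) _ => //.
apply: (@le_trans _ _ (\sum_(Y in [set Y : {set {set 'I_n}} | (Y \subset layer k)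
    & #|Y| == m k]) exp (- ((m k)%:R * rate k)))); last first.
  by rewrite sumr_const cards_draws card_layer [leRHS]mulr_natl.
rewrite big_mkcond [X in _ <= X]big_mkcond; apply: ler_sum => Y _ /=.
rewrite !inE; case: ifP => // /andP[Yk /eqP Ym].
by rewrite -Ym; apply: (Pr_stuck Mn) => //; lia.
Qed.

End UnionBound.

(** * Asymptotics *)

(** The left side is one term of the expansion of [(1 + x) ^+ N]. *)
Lemma bin_exp_le (N m : nat) (x : R) : 0 <= x ->
  'C(N, m)%:R * x ^+ m <= exp (N%:R * x).
Proof.
move=> x0; apply: (@le_trans _ _ ((1 + x) ^+ N)); last first.
  rewrite -exp_mulrn; apply: lerXn2r; rewrite ?nnegrE ?exp_ge0 ?addr_ge0 //.
  exact: exp_ge1Dx.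
have [mN|mN] := leqP m N; last by rewrite bin_small // mul0r exprn_ge0 // addr_ge0.
rewrite exprDn (bigD1 (Ordinal (mN : (m < N.+1)%N))) //= expr1n mul1r mulr_natl lerDl.
by apply: sumr_ge0 => i _; rewrite mulrn_wge0 // mulr_ge0 ?exprn_ge0.
Qed.

Lemma bin_pow2_le (n k : nat) : (200 * (20 * k) <= n)%N ->
  'C(n, k)%:R * 2 ^+ k <= exp (n%:R / 200) :> R.
Proof.
move=> kn.
have e1 : 2 <= exp 1 by have := exp_ge1Dx 1; lra.
have e10 : 1000 <= exp 10.
  have := lerXn2r 10 _ _ e1; rewrite ?nnegrE exp_mulrn mulr1 => h.
  by apply: le_trans (h _ (exp_ge0 _)); rewrite ?nnegrE //; lra.
(* Take x = 1/500 in [bin_exp_le]; the cost [1000 ^+ k] is at most [exp (10 * k)], which is small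
   because k is at most n/4000. *)
have -> : 2 ^+ k = 500^-1 ^+ k * 1000 ^+ k :> R.
  by rewrite -exprMn; congr (_ ^+ k); lra.
have -> : n%:R / 200 = n%:R * 500^-1 + n%:R * (3 / 1000) :> R by lra.
rewrite [leLHS]mulrA exp_add; apply: ler_pM.
- by rewrite mulr_ge0 // exprn_ge0 // invr_ge0.
- by rewrite exprn_ge0.
- by apply: bin_exp_le; rewrite invr_ge0.
apply: (@le_trans _ _ (exp 10 ^+ k)).
  by apply: lerXn2r => //; rewrite nnegrE ?exp_ge0.
rewrite exp_mulrn; apply: exp_le; move: kn (ler0n R n); rewrite -(ler_nat R) !natrM; lra.
Qed.

Lemma bin_ge_pow2 n k : (3 * k <= n.+1)%N -> (2 ^ k <= 'C(n, k))%N.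
Proof.
elim: k => [|k IH] kn; first by rewrite bin0.
by rewrite expnS; have := bin_double kn; have := IH _; lia.
Qed.

(** The ratio of consecutive binomials is [n.+1 / k.+1 - 1]. The loss 22 is this 1, another 1 for
    the time already elapsed, and 20 for rounding in [fill_time]. *)
Lemma rate_ge n k : (0 < k)%N -> (200 * (20 * k.+1) <= n)%N ->
  (n.+1%:R / k.+1%:R - 22) / 80 <= rate n k.
Proof.
move=> k0 kn; rewrite /rate.
have kn' : (k <= n)%N by lia.
have N1 : 1 <= 'C(n, k)%:R :> R by rewrite ler1n bin_gt0.
have N0 : 0 < 'C(n, k)%:R :> R by lra.
have k10 : 0 < k.+1%:R :> R by rewrite ltr0n.
have le_t : (fill_time n k.-1 <= fill_time n k)%N.
  by apply: (@leq_fill_time n (n %/ 3)); lia.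
have h1 : 'C(n, k.+1)%:R <= 20 * (fill_time n k)%:R + 20 :> R.
  have : ('C(n, k.+1) <= 20 * fill_time n k + 20)%N by rewrite /fill_time; lia.
  by rewrite -(ler_nat R) natrD natrM.
have h2 : 20 * (fill_time n k.-1)%:R <= 'C(n, k)%:R :> R.
  have : (20 * fill_time n k.-1 <= 'C(n, k))%N by rewrite /fill_time prednK //; lia.
  by rewrite -(ler_nat R) natrM.
have h3 : k.+1%:R * 'C(n, k.+1)%:R = (n%:R - k%:R) * 'C(n, k)%:R :> R.
  by rewrite -natrB // -!natrM mul_bin_left.
rewrite natrB // ler_pdivlMr ?mulr_gt0 //.
have -> : n.+1%:R / k.+1%:R = (n%:R - k%:R) / k.+1%:R + 1 :> R.
  by rewrite -[k.+1%:R]natr1 -[n.+1%:R]natr1; field; rewrite natr1 pnatr_eq0.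
have -> : (n%:R - k%:R) / k.+1%:R = 'C(n, k.+1)%:R / 'C(n, k)%:R :> R.
  apply/eqP; rewrite eqr_div ?pnatr_eq0 -?lt0n ?bin_gt0 //.
  by rewrite -h3 mulrC.
set N := 'C(n, k)%:R in N0 N1 h2 *; set N' := 'C(n, k.+1)%:R in h1 *.
have -> : (N' / N + 1 - 22) / 80 * (4 * N) = (N' - 21 * N) / 20 by field; rewrite gt_eqF.
lra.
Qed.

Section Asymptotics.

(** L plays the role of log n and v that of the square root of n, which separates the two regimes of
    [sparse_small]. *)
Variables (n q : nat) (K L v : R).
Hypothesis K0 : 0 < K.
Hypothesis L0 : 0 < L.
Hypothesis KL : 1000 <= K * L.
Hypothesis vL : 1000 * ((1 + K) * (1 + L)) <= v.
Hypothesis nv : n%:R = v ^+ 2.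
Hypothesis nL : n%:R = exp L.
Hypothesis q_le : q%:R * (150 * (K * L)) <= n%:R.

Let v_ge : 1000 + 1000 * L + 1000 * (K * L) <= v.
Proof.
have := K0; have := vL; have -> : (1 + K) * (1 + L) = 1 + K + L + K * L by ring.
lra.
Qed.

Let n_ge : 1000 * v <= n%:R.
Proof.
have := v_ge; have := L0; have := KL => *.
by rewrite nv expr2; apply: ler_wpM2r; lra.
Qed.

Lemma q_small : (200 * (20 * q.+1) <= n)%N.
Proof.
rewrite -(ler_nat R) !natrM -[q.+1%:R]natr1.
have : q%:R * (150 * 1000) <= q%:R * (150 * (K * L)) :> R.
  by rewrite ler_wpM2l //; have := KL; lra.
have := n_ge; have := v_ge; have := q_le; have := KL; have := L0; lra.
Qed.

Let level_small k : (k <= q)%N -> (200 * (20 * k.+1) <= n)%N.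
Proof. by move=> kq; have := q_small; clear -kq; lia. Qed.

Let small_real k : (k <= q)%N -> 200 * (20 * (k%:R + 1)) <= n%:R :> R.
Proof. by move/level_small; rewrite -(ler_nat R) !natrM -[k.+1%:R]natr1. Qed.

Lemma escape_small :
  'C(n, q.+1)%:R * (20^-1) ^+ (n %/ 3 - q.+1) <= exp (- L).
Proof.
have qs := q_small.
(* The crude bound [20^-1 <= exp (- 2^-1)] suffices: at least n/4 levels separate q+1 from n/3. *)
apply: (@le_trans _ _ (exp (n%:R / 200) * exp (- 2^-1) ^+ (n %/ 3 - q.+1))).
  apply: ler_pM; rewrite ?exprn_ge0 ?invr_ge0 //.
    apply: le_trans (bin_pow2_le qs); rewrite ler_peMr // exprn_ege1 //; lra.
  apply: lerXn2r; rewrite ?nnegrE ?exp_ge0 ?invr_ge0 //.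
  by have := exp_ge1Dx (- 2^-1); lra.
rewrite exp_mulrn -exp_add; apply: exp_le.
have : (n <= 4 * (n %/ 3 - q.+1))%N by clear -qs; lia.
rewrite -(ler_nat R) natrM; have := n_ge; have := v_ge; have := KL; have := L0; lra.
Qed.

Lemma shaded_small k : (k <= q)%N ->
  'C(n, k)%:R * exp (- ((n - k)%:R / 80)) <= exp (- (2 * L)).
Proof.
move=> kq; have ks := level_small kq.
apply: (@le_trans _ _ (exp (n%:R / 200) * exp (- ((n - k)%:R / 80)))).
  rewrite ler_pM2r; last exact/RltP/exp_pos.
  have ks' : (200 * (20 * k) <= n)%N by clear -ks; lia.
  apply: le_trans (bin_pow2_le ks'); rewrite ler_peMr // exprn_ege1 //; lra.
rewrite -exp_add; apply: exp_le; rewrite natrB; last by clear -ks; lia.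
have := small_real kq; have := n_ge; have := v_ge; have := KL; have := L0; lra.
Qed.

(** The choices of z and Y cost n/200 in the exponent, while half a neighbourhood gains nearly
    n/160. *)
Lemma hole_small k : (0 < k <= q)%N ->
  'C(n, k.+1)%:R * 2 ^+ k.+1 * exp (- (k.+1%:R / 2 * rate n k)) <= exp (- (2 * L)).
Proof.
move=> /andP[k0 kq]; have ks := level_small kq; have rk := rate_ge k0 ks.
apply: (@le_trans _ _ (exp (n%:R / 200) * exp (- (k.+1%:R / 2 * rate n k)))).
  by rewrite ler_pM2r ?bin_pow2_le //; exact/RltP/exp_pos.
rewrite -exp_add; apply: exp_le.
have k10 : 0 < k.+1%:R :> R by rewrite ltr0n.
have : k.+1%:R / 2 * ((n.+1%:R / k.+1%:R - 22) / 80) <= k.+1%:R / 2 * rate n k.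
  by rewrite ler_wpM2l //; lra.
have -> : k.+1%:R / 2 * ((n.+1%:R / k.+1%:R - 22) / 80) =
    (n.+1%:R - 22 * k.+1%:R) / 160 :> R.
  by field; rewrite ?nat1r gt_eqF.
have := small_real kq; have := n_ge; have := v_ge; have := KL; have := L0.
rewrite -[k.+1%:R]natr1 -[n.+1%:R]natr1; lra.
Qed.

(** The least integer exceeding the allowed number of missing vertices, ['C(n, k)] over the K-th
    power of n. *)
Definition sparse_size k := (Num.truncn ('C(n, k)%:R * exp (- (K * L)))).+1.

Lemma sparse_sizeP k : (sparse_size k)%:R - 1 <= 'C(n, k)%:R * exp (- (K * L)) <
  (sparse_size k)%:R.
Proof.
have h : 0 <= 'C(n, k)%:R * exp (- (K * L)) by rewrite mulr_ge0 ?exp_ge0.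
have /andP[h1 h2] := truncn_itv h.
by rewrite /sparse_size h2 andbT -[_.+1%:R]natr1 addrK.
Qed.

Lemma sparse_small k : (0 < k <= q)%N ->
  'C('C(n, k), sparse_size k)%:R * exp (- ((sparse_size k)%:R * rate n k))
    <= exp (- (2 * L)).
Proof.
move=> /andP[k0 kq]; have ks := level_small kq; have rk := rate_ge k0 ks.
have /andP[_ m_gt] := sparse_sizeP k; have m1 : 1 <= (sparse_size k)%:R :> R by rewrite ler1n.
set m := sparse_size k in m_gt m1 *.
have k10 : 0 < k.+1%:R :> R by rewrite ltr0n.
(* [bin_exp_le] with [x = exp (- (K * L))], for which ['C(n, k) * x < m]. *)
have binm : 'C('C(n, k), m)%:R <= exp (m%:R * (1 + K * L)).
  rewrite mulrDr exp_add mulr1.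
  have := @bin_exp_le 'C(n, k) m _ (exp_ge0 (- (K * L))).
  rewrite exp_mulrn mulrN => h.
  have -> : 'C('C(n, k), m)%:R =
     'C('C(n, k), m)%:R * exp (- (m%:R * (K * L))) * exp (m%:R * (K * L)).
    by rewrite -mulrA -exp_add addNr exp_0 mulr1.
  rewrite ler_pM2r; last exact/RltP/exp_pos.
  by apply: le_trans h _; apply: exp_le; apply: ltW.
apply: (@le_trans _ _ (exp (m%:R * (1 + K * L)) * exp (- (m%:R * rate n k)))).
  by rewrite ler_pM2r //; exact/RltP/exp_pos.
rewrite -exp_add; apply: exp_le.
have -> : m%:R * (1 + K * L) - m%:R * rate n k = m%:R * (1 + K * L - rate n k) by ring.
have m0 : 0 <= m%:R :> R by [].
have := v_ge; have := KL; have := L0 => L0' KL' v_ge'.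
set y := n.+1%:R / k.+1%:R in rk.
(* On low levels the rate is at least of order v, and a single vertex suffices. On higher ones the
   rate beats [K * L] only by a constant factor, but m is large. *)
have [kv|kv] := leP k.+1%:R v.
  have nk : v <= y.
    rewrite ler_pdivlMr // -[n.+1%:R]natr1 nv expr2.
    have : v * k.+1%:R <= v * v by apply: ler_wpM2l => //; lra.
    lra.
  have : m%:R * (1 + K * L - rate n k) <= m%:R * - (2 * L).
    by apply: ler_wpM2l => //; lra.
  have : 2 * L <= m%:R * (2 * L) by rewrite ler_peMl //; lra.
  lra.
(* The constant 150 is used here: the rate is at least [120 / 80 * (K * L)], which exceeds the
   entropy [1 + K * L] by at least 1. *)
have nk : 120 * (K * L) + 22 <= y.
  rewrite ler_pdivlMr // -[k.+1%:R]natr1 -[n.+1%:R]natr1.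
  have : k%:R * (150 * (K * L)) <= q%:R * (150 * (K * L)).
    by apply: ler_wpM2r; [lra|rewrite ler_nat].
  have := n_ge; have := q_le; have := small_real kq; lra.
have mk : k%:R / 2 - K * L <= m%:R.
  apply: le_trans (ltW m_gt).
  apply: (@le_trans _ _ (exp (k%:R / 2 - K * L))).
    by have := exp_ge1Dx (k%:R / 2 - K * L); lra.
  rewrite exp_add ler_pM2r; last exact/RltP/exp_pos.
  apply: (@le_trans _ _ (2 ^+ k)); last by rewrite -natrX ler_nat bin_ge_pow2 //; clear -ks; lia.
  rewrite -exp_mulrn; apply: lerXn2r; rewrite ?nnegrE ?exp_ge0 //.
  by have := @exp_half 1; rewrite mul1r; lra.
have : m%:R * (1 + K * L - rate n k) <= m%:R * -1.
  by apply: ler_wpM2l => //; lra.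
by move: kv; rewrite -[k.+1%:R]natr1; lra.
Qed.

(** The escape costs 1/n, and each of at most n levels costs three terms [exp (- (2 * L))], that is
    3/n in total. *)
Lemma Pr_bad_small :
  Pr (2 ^ n) (@bad n (n %/ 3)%N q sparse_size) <= 4 / n%:R.
Proof.
have qs := q_small; have n0 : 0 < n%:R :> R by rewrite ltr0n; clear -qs; lia.
apply: le_trans (Pr_bad _ _ _) _; [clear; lia|clear -qs; lia|].
have eL : exp (- L) = n%:R^-1.
  have n0' : n%:R != 0 :> R by rewrite gt_eqF.
  by apply: (mulfI n0'); rewrite divff // nL -exp_add subrr exp_0.
apply: (@le_trans _ _ (exp (- L) + \sum_(1 <= k < q.+1) 3 * exp (- (2 * L)))).
  apply: lerD; first exact: escape_small.
  rewrite big_nat_cond [leRHS]big_nat_cond; apply: ler_sum => k; rewrite andbT ltnS => kq.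
  have /andP[k0 kq'] := kq.
  have := shaded_small kq'; have := hole_small kq; have := sparse_small kq; lra.
rewrite sumr_const_nat subn1 /= -mulr_natl.
have -> : - (2 * L) = - L + - L by ring.
rewrite exp_add eL.
have qn : q%:R <= n%:R :> R by rewrite ler_nat; clear -qs; lia.
have : q%:R * (3 * (n%:R^-1 / n%:R)) <= n%:R * (3 * (n%:R^-1 / n%:R)) :> R.
  by rewrite ler_wpM2r // mulr_ge0 // divr_ge0 // invr_ge0.
have -> : n%:R * (3 * (n%:R^-1 / n%:R)) = 3 / n%:R :> R by field; rewrite gt_eqF.
lra.
Qed.

End Asymptotics.

(** * From the bad events to the stated probability *)

Lemma prob_goodE n K :
  prob_good n K = Pr (2 ^ n) (fun w : seq 'S_n => good_event K (cluster_after w)).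
Proof. by rewrite -Pr_ffun ?card_perm_gt0 // /prob_good RdivE !INRE. Qed.

Lemma Rleb_le (a b : R) : Defs.Rleb a b = (a <= b).
Proof.
by rewrite /Defs.Rleb; case: Rle_dec => h; apply/esym; [apply/RleP|apply/negP => /RleP].
Qed.

Lemma good_event_count (n q : nat) (K : R) (C : {set {set 'I_n}}) :
  0 < K * ln n%:R -> q = Num.truncn (n%:R / (150 * (K * ln n%:R))) ->
  (forall k, (k <= q)%N ->
     ('C(n, k) < level_count C k + sparse_size n K (ln n%:R) k)%N) ->
  good_event K C.
Proof.
move=> KL0 qE Ck; apply/forallP => k; apply/implyP; rewrite !Rleb_le.
have e150 : IZR 150 = 150 by rewrite IZRposE INRE.
rewrite e150 !RealsE -mulrA => kq.
have {}kq : (k <= q)%N.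
  by rewrite qE truncn_ge_nat // divr_ge0 // mulr_ge0 // ltW.
have /andP[h _] := @sparse_sizeP n K (ln n%:R) k.
have -> : (Rpower n%:R K)^-1 = exp (- (K * ln n%:R)).
  by rewrite -RinvE -RoppE exp_Ropp.
(* The strict integer inequality supplies the 1 that turns [sparse_size] into a lower bound for the
   allowed number of missing vertices. *)
have := Ck k kq; rewrite -(ler_nat R) natrD -['C(n, k).+1%:R]natr1.
set N := 'C(n, k)%:R in h *; set m := (sparse_size _ _ _ _)%:R in h *.
by rewrite (_ : R1 = 1) //; lra.
Qed.

Theorem theorem2 : forall K : R, Rlt R0 K -> Un_cv (fun n => prob_good n K) R1.
Proof.
move=> K /RltP K_gt0 eps /RltP eps_gt0.
have K0 : 0 < K by [].
have eps0 : 0 < eps by [].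
(* With [A <= L], the first summand gives [1000 <= K * L], the second lets [(1 + L / 4) ^+ 2]
   dominate [1000 * (1 + K) * (1 + L)]. *)
pose A : R := 1000 / K + 16 * (1000 * (1 + K)).
have K1 : 0 < 1000 / K by rewrite divr_gt0.
have A0 : 0 < A by rewrite /A; lra.
(* Beyond this threshold both [A <= ln n] and [4 / n < eps] hold. *)
exists (Num.truncn (exp A + 4 / eps)).+1 => n /ssrnat.leP n_ge.
have n_gt : exp A + 4 / eps < n%:R.
  have h : 0 <= exp A + 4 / eps by rewrite addr_ge0 ?exp_ge0 // divr_ge0 // ltW.
  have /andP[_ /lt_le_trans] := truncn_itv h; apply.
  by rewrite ler_nat.
have e0 : 0 < exp A by apply/RltP/exp_pos.
have d0 : 0 < 4 / eps by rewrite divr_gt0.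
have n0 : 0 < n%:R :> R by lra.
pose L := ln n%:R.
have nL : n%:R = exp L by rewrite /L exp_ln //; apply/RltP.
have AL : A <= L.
  rewrite leNgt; apply/negP => /ltW /exp_le; rewrite -nL; lra.
have L0 : 0 < L by lra.
have KL : 1000 <= K * L.
  have : 1000 / K <= L by move: AL; rewrite /A; lra.
  by rewrite ler_pdivrMr // mulrC.
pose v := exp (L / 2).
have nv : n%:R = v ^+ 2 by rewrite expr2 -exp_add nL; congr exp; lra.
have vL : 1000 * ((1 + K) * (1 + L)) <= v.
  have e4 := exp_ge1Dx (L / 4).
  have -> : v = exp (L / 4) * exp (L / 4) by rewrite -exp_add; congr exp; lra.
  apply: (@le_trans _ _ ((1 + L / 4) * (1 + L / 4))); last by apply: ler_pM => //; lra.
  have h1 : 16 * (1000 * (1 + K)) * (1 + L) <= (1 + L) * (1 + L).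
    by rewrite ler_wpM2r //; [lra|move: AL; rewrite /A; lra].
  have : 0 <= L * L by rewrite mulr_ge0 // ltW.
  lra.
pose q := Num.truncn (n%:R / (150 * (K * L))).
have KL0 : 0 < 150 * (K * L) by lra.
have q_le : q%:R * (150 * (K * L)) <= n%:R.
  rewrite -ler_pdivlMr // /q.
  have h : 0 <= n%:R / (150 * (K * L)) by rewrite divr_ge0 // ltW.
  by have /andP[] := truncn_itv h.
have bnd := Pr_bad_small K0 L0 KL vL nv nL q_le.
have qs := q_small K0 L0 KL vL nv q_le.
have good : 1 - 4 / n%:R <= prob_good n K.
  rewrite prob_goodE.
  apply: (@le_trans _ _ (Pr (2 ^ n) (fun w => ~~ bad (n %/ 3)%N q (sparse_size n K L) w))).
    by rewrite PrC ?card_perm_gt0 //; lra.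
  apply: Pr_le; first exact: card_perm_gt0.
  move=> w nbad; apply: (@good_event_count n q) => // [|k kq].
    by rewrite -/L; lra.
  by apply: (level_count_good _ _ _ nbad) => //; clear -qs; lia.
have le1 : prob_good n K <= 1.
  rewrite prob_goodE -[leRHS](Ex_cst (card_perm_gt0 n) (2 ^ n)).
  by apply: Ex_le; [exact: card_perm_gt0|move=> w; rewrite lern1 leq_b1].
have small : 4 / n%:R < eps.
  rewrite ltr_pdivrMr // mulrC -ltr_pdivrMr //; lra.
apply/RltP; rewrite RealsE distrC ger0_norm ?subr_ge0 //.
by rewrite (_ : R1 = 1) //; lra.
Qed.
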